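(* For every $p$ with $1<p\le\infty$, the Cesàro operator $C$, $(Cf)(z)=\frac{1}{z}\int_0^z f(\zeta)\,d\zeta$ for $z\in\mathbb{C}_+$, is bounded on the Hardy space $H^p(\mathbb{C}_+)$; that is, $C$ maps $H^p(\mathbb{C}_+)$ into itself and there is a constant $M_p<\infty$ such that $\|Cf\|_p\le M_p\|f\|_p$ for all $f\in H^p(\mathbb{C}_+)$.
   Context: $\mathbb{C}_+=\{z=x+iy: x\in\mathbb{R},\,y>0\}$ is the upper half-plane. For $1\le p<\infty$, $H^p(\mathbb{C}_+)$ is the space of functions $f$ holomorphic in $\mathbb{C}_+$ with $\|f\|_p=\left[\sup_{y>0}\int_{-\infty}^{\infty}|f(x+iy)|^p\,dx\right]^{1/p}<\infty$. $H^\infty(\mathbb{C}_+)$ is the space of bounded holomorphic functions on $\mathbb{C}_+$ with $\|f\|_\infty=\sup_{z\in\mathbb{C}_+}|f(z)|$. The integral $\int_0^z f(\zeta)\,d\zeta$ is taken along the segment from $0$ to $z$, so that $(Cf)(z)=\int_0^1 f(zs)\,ds$. *)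

(* Defs.v *)
From HB Require Import structures.
From mathcomp Require Import all_boot all_order all_algebra.
From mathcomp Require Import complex.
From mathcomp Require Import all_classical all_reals all_analysis.
Set Implicit Arguments.
Unset Strict Implicit.
Unset Printing Implicit Defensive.
Import Order.TTheory GRing.Theory Num.Theory.
Import numFieldNormedType.Exports.
Local Open Scope classical_set_scope.
Local Open Scope complex_scope.
Local Open Scope ring_scope.

(* A function on the upper half-plane is represented by a total function
   R[i] -> R[i]; the definitions below only look at its values on the upper
   half-plane. *)
Definition upper_half_plane (R : realType) : set R[i] :=
  [set z | 0 < complex.Im z].

(* R[i]^o is the normed module R[i] over the field R[i], so that [derivable]
   in direction 1 says that (f (z + h) - f z) / h has a limit as the complex
   number h tends to 0. *)
Definition holomorphic_on (R : realType) (A : set R[i]) (f : R[i] -> R[i]) :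
    Prop :=
  forall z, A z -> derivable (f : R[i]^o -> R[i]^o) (z : R[i]^o) 1.

(* The junk value at p = -oo is never used. *)
Definition hardy_norm (R : realType) (p : \bar R) (f : R[i] -> R[i]) : \bar R :=
  match p with
  | r%:E =>
      ((ereal_sup
         [set \int[lebesgue_measure]_x (Normc.normc (f (x +i* y)%C) `^ r)%R%:E
         | y in [set y : R | (0 < y)%R]]) `^ r^-1)%E
  | +oo%E =>
      ereal_sup [set (Normc.normc (f z))%:E | z in @upper_half_plane R]
  | -oo%E => 0%E
  end.

Definition hardy (R : realType) (p : \bar R) : set (R[i] -> R[i]) :=
  [set f | holomorphic_on (@upper_half_plane R) f /\ (hardy_norm p f < +oo)%E].

(* The parametrization of the segment from a to b; it is used on the open
   interval ]0, 1[, because the integrand may be undefined at an endpoint. *)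
Definition segment_path (R : realType) (a b : R[i]) (s : R) : R[i] :=
  a + s%:C * (b - a).

Definition segment_integrable (R : realType) (f : R[i] -> R[i]) (a b : R[i]) :
    Prop :=
  lebesgue_measure.-integrable `]0%R, 1%R[
    (EFin \o (fun s : R => complex.Re (f (segment_path a b s)))) /\
  lebesgue_measure.-integrable `]0%R, 1%R[
    (EFin \o (fun s : R => complex.Im (f (segment_path a b s)))).

Definition segment_integral (R : realType) (f : R[i] -> R[i]) (a b : R[i]) :
    R[i] :=
  (b - a) *
  (Rintegral lebesgue_measure `]0%R, 1%R[
     (fun s : R => complex.Re (f (segment_path a b s)))
   +i* Rintegral lebesgue_measure `]0%R, 1%R[
     (fun s : R => complex.Im (f (segment_path a b s))))%C.

Definition cesaro_operator (R : realType) (f : R[i] -> R[i]) (z : R[i]) : R[i] :=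
  z^-1 * segment_integral f 0 z.

(* Main.v *)
Require Import Defs.
From mathcomp Require Import all_boot all_order all_algebra.
From mathcomp Require Import complex.
From mathcomp Require Import all_classical all_reals all_analysis.
From mathcomp Require Import ring lra.
From mathcomp Require Import measurable_realfun.

(** The mean value of f over the ray from 0 to z = x + iy involves only the
    values f(sx + isy) with 0 < s < 1, so the norm bound is a statement about
    dilations.  For finite p, the split v <= A + A^(1-p) v^p with
    A = a / sqrt s gives, for every a > 0,
      int_0^1 |f(sz)| ds <= 2a + a^(1-p) W(x),
      W(x) = int_0^1 s^((p-1)/2) |f(sz)|^p ds,
    and the best a, namely W(x)^(1/p), turns this into |Cf(z)|^p <= 6^p W(x).
    This replaces Hoelder's inequality.  By Tonelli's theorem and the scaling
    x -> sx of Lebesgue measure, the integral of W along a horizontal line is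
    at most the supremum of the horizontal integrals of |f|^p times
    int_0^1 s^((p-1)/2 - 1) ds = 2/(p-1) (cesaro_power_integral).  For
    p = +oo the bound is immediate.

    What remains is complex analysis: f must be integrable near the vertex 0
    of the segment, and Cf must be holomorphic.

    Both rest on Goursat's theorem for rectangles (goursat), proved by
    bisection.  It provides a primitive F of f on the half-plane, as an
    integral along a horizontal and then a vertical segment
    (cderiv_primitive).  Applied to the difference quotient of f at z0, which
    is continuous at z0 and differentiable elsewhere, it gives Cauchy's formula
    on a square centred at z0, up to the value of the integral of 1/(z - z0),
    for which the lower bound 4 is enough (rect_inv_ge4).  Averaging the
    resulting estimate of |f(z0)| by integrals over the four sides, as the
    size of the square varies, bounds |f(z0)| by integrals over horizontal
    lines, whence |f(x + iy)| <= K y^(-1/p) (growth_bound).  Since p > 1, this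
    is integrable along rays.

    Finally z Cf(z) is the integral of f from 0 to z, which is F(z) minus the
    limit of F(ez) as e tends to 0.  By the growth bound,
    F(ez) - F(ez') = O(e^(1 - 1/p)), so that limit does not depend on z
    (ray_integral_primitive): Cf(z) = (F(z) + k) / z for a constant k, and Cf
    is holomorphic. *)

Set Implicit Arguments.
Unset Strict Implicit.
Unset Printing Implicit Defensive.
Import Order.TTheory GRing.Theory Num.Theory.
Import numFieldNormedType.Exports.
Local Open Scope classical_set_scope.
Local Open Scope complex_scope.
Local Open Scope ring_scope.

(** * Modulus and complex derivative *)

Section complex_modulus.
Variable R : realType.
Implicit Types z w : R[i].
Notation normc := (@Normc.normc R).

Lemma normc_ge0 z : 0 <= normc z.
Proof. by case: z => a b; rewrite /= sqrtr_ge0. Qed.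

Lemma normr_Re_le z : `|complex.Re z| <= normc z.
Proof.
case: z => a b /=; rewrite -sqrtr_sqr ler_wsqrtr// lerDl sqr_ge0//.
Qed.

Lemma normr_Im_le z : `|complex.Im z| <= normc z.
Proof.
case: z => a b /=; rewrite -sqrtr_sqr ler_wsqrtr// lerDr sqr_ge0//.
Qed.

Lemma normc_le_ReIm z : normc z <= `|complex.Re z| + `|complex.Im z|.
Proof.
case: z => a b /=; rewrite -[leRHS]ger0_norm ?addr_ge0// -sqrtr_sqr ler_wsqrtr//.
rewrite sqrrD !real_normK ?num_real//.
have : 0 <= `|a| * `|b| by rewrite mulr_ge0.
by lra.
Qed.

Lemma normc_opp z : normc (- z) = normc z.
Proof. exact: normcN. Qed.

Lemma normc_triangle z w : normc (z + w) <= normc z + normc w.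
Proof. exact: le_normcD. Qed.

Lemma normcB z w : normc (z - w) = normc (w - z).
Proof. by rewrite -normc_opp opprB. Qed.

Lemma lenormcB z w : normc z - normc w <= normc (z - w).
Proof. by rewrite lerBlDr (le_trans _ (normc_triangle _ _))// subrK. Qed.

Lemma normc_real (x : R) : normc x%:C = `|x|.
Proof. by rewrite /= expr0n addr0 sqrtr_sqr. Qed.

Lemma normc_i : normc 'i%C = 1 :> R.
Proof. by rewrite /= expr0n add0r expr1n sqrtr1. Qed.

Lemma normc_eq0 z : (normc z == 0) = (z == 0).
Proof.
by apply/eqP/eqP => [/Normc.eq0_normc//|->]; rewrite Normc.normc0.
Qed.

Lemma normc_gt0 z : (0 < normc z) = (z != 0).
Proof. by rewrite lt_def normc_ge0 andbT normc_eq0. Qed.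

End complex_modulus.

Section complex_derivative.
Variable R : realType.
Implicit Types (f : R[i] -> R[i]) (z w l : R[i]).
Notation normc := (@Normc.normc R).

Definition cderiv f z l := forall e : R, 0 < e ->
  exists2 d, 0 < d & forall h, normc h < d ->
    normc (f (z + h) - f z - l * h) <= e * normc h.

Definition ccont f z := forall e : R, 0 < e ->
  exists2 d, 0 < d & forall w, normc (w - z) < d -> normc (f w - f z) < e.

(** Neighbourhoods in the normed space R[i] over itself are given by radii
    that are complex numbers; all estimates below use real radii, so this is
    the only place where that topology is seen. *)
Lemma derivable_cderiv f z :
  derivable (f : R[i]^o -> R[i]^o) (z : R[i]^o) 1 <-> exists l, cderiv f z l.
Proof.
split.
- move=> /cvg_ex[/= l /cvgrPdist_le fl]; exists l => e e0.
  have eC : 0 < e%:C by rewrite ltcR.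
  have := fl _ eC.
  rewrite /nbhs/= /nbhs_ball_/= => -[d/= d0 H].
  have dR : d = (complex.Re d)%:C.
    by rewrite RRe_real// gtr0_real.
  have d0R : 0 < complex.Re d by move: d0; rewrite [in X in X -> _]dR ltcR.
  exists (complex.Re d) => // h hd.
  have [->|h0] := eqVneq h 0.
    by rewrite addr0 subrr mulr0 subrr Normc.normc0 mulr0.
  have := H h; rewrite /ball_/= sub0r normrN.
  have -> : (`|h| < d) by rewrite dR normc_def ltcR; move: hd; case: (h).
  move=> /(_ isT h0).
  rewrite -[h *: 1]/(h * 1) mulr1 -[_ *: _]/(h^-1 * (f (h + z) - f z)).
  have E : l - h^-1 * (f (h + z) - f z) = - h^-1 * (f (z + h) - f z - l * h).
    by rewrite (addrC h); field.
  rewrite E -[X in X <= _]/((normc _)%:C) lecR Normc.normcM normc_opp.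
  rewrite Normc.normcV => X.
  rewrite -ler_pdivrMr ?normc_gt0// mulrC//.
- move=> [l fl]; apply/cvg_ex; exists l; apply/cvgrPdist_le => /= e e0.
  have eR : e = (complex.Re e)%:C by rewrite RRe_real// gtr0_real.
  have e0R : 0 < complex.Re e by move: e0; rewrite [in X in X -> _]eR ltcR.
  have [d d0 H] := fl _ e0R.
  rewrite /nbhs/= /nbhs_ball_/=; exists d%:C => /=; first by rewrite ltcR.
  move=> h; rewrite /ball_/= sub0r normrN -[X in X < _]/((normc _)%:C) ltcR.
  move=> hd h0.
  rewrite -[h *: 1]/(h * 1) mulr1 -[_ *: _]/(h^-1 * (f (h + z) - f z)).
  have E : l - h^-1 * (f (h + z) - f z) = - h^-1 * (f (z + h) - f z - l * h).
    by rewrite (addrC h); field.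
  rewrite E -[X in X <= _]/((normc _)%:C) eR lecR Normc.normcM normc_opp.
  by rewrite Normc.normcV mulrC ler_pdivrMr ?normc_gt0// H.
Qed.

Lemma cderiv_ccont f z l : cderiv f z l -> ccont f z.
Proof.
move=> fl e e0; have [d d0 H] := fl 1 ltr01.
have k0 : 0 < 2 + normc l by have := normc_ge0 l; lra.
exists (Num.min d (e / (2 + normc l))).
  by rewrite lt_min d0 divr_gt0.
move=> w; rewrite lt_min => /andP[wd we].
have := H _ wd; rewrite (addrC z) subrK mul1r => {}H.
have -> : f w - f z = (f w - f z - l * (w - z)) + l * (w - z) by rewrite subrK.
rewrite (le_lt_trans (normc_triangle _ _))// Normc.normcM.
move: we; rewrite ltr_pdivlMr// => we.
have := normc_ge0 (w - z); have := normc_ge0 l; nra.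
Qed.

End complex_derivative.

(** * Oriented integrals of complex-valued functions of a real variable *)

Section oriented_integral.
Variable R : realType.
Notation mu := (@lebesgue_measure R).
Implicit Types (a b c t : R) (g h : R -> R).

Definition between a b t := (a <= t <= b) || (b <= t <= a).

Lemma betweenC a b t : between a b t = between b a t.
Proof. by rewrite /between orbC. Qed.

Lemma betweenP a b t : a <= b -> between a b t = (a <= t <= b).
Proof.
rewrite /between => ab; apply/idP/idP => [/orP[//|/andP[bt ta]]|->//].
by apply/andP; split; lra.
Qed.

Lemma continuous_integrable_itv a b g :
  (forall t, a <= t <= b -> {for t, continuous g}) ->
  mu.-integrable `[a, b] (EFin \o g).
Proof.
move=> cg; apply: continuous_compact_integrable; first exact: segment_compact.
by apply: continuous_in_subspaceT => t; rewrite inE/= in_itv/= => /cg.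
Qed.

(** One of the two intervals is empty or a single point, so this is the usual
    signed integral, without a case distinction on the order of a and b. *)
Definition ointr a b g :=
  Rintegral mu `[a, b] g - Rintegral mu `[b, a] g.

Lemma ointr_swap a b g : ointr b a g = - ointr a b g.
Proof. by rewrite /ointr opprB. Qed.

Lemma ointr_le a b g : a <= b -> ointr a b g = Rintegral mu `[a, b] g.
Proof.
rewrite le_eqVlt /ointr => /predU1P[->|ab].
  by rewrite set_itv1 Rintegral_set1 subr0.
by rewrite [X in _ - Rintegral _ X _]set_itv_ge ?bnd_simp -?ltNge//
  Rintegral_set0 subr0.
Qed.

(** From a base point m to the left of a, b and c, every integral is a
    difference of two integrals over intervals starting at m. *)
Lemma ointr_chasles a b c g :
  (forall t, [|| between a b t, between b c t | between a c t] -> {for t, continuous g}) ->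
  ointr a b g + ointr b c g = ointr a c g.
Proof.
move=> cg.
pose m := Num.min a (Num.min b c).
have ma : m <= a by rewrite ge_min lexx.
have mb : m <= b by rewrite /m !ge_min lexx orbT.
have mc : m <= c by rewrite /m !ge_min lexx !orbT.
have key x y : m <= x -> x <= y -> (y = a \/ y = b \/ y = c) ->
    ointr x y g = ointr m y g - ointr m x g.
  move=> mx xy hy.
  rewrite (ointr_le _ xy) (ointr_le _ mx) (ointr_le _ (le_trans mx xy)).
  have ig : mu.-integrable `[m, y] (EFin \o g).
    apply: continuous_integrable_itv => t /andP[mt ty]; apply: cg.
    move: mt; rewrite /m !ge_min /between.
    case: hy => [|[]] E; rewrite E in ty *; rewrite ty => /or3P[] h;
      by rewrite h /= ?andbT ?le_total ?orbT//= orbA le_total.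
  rewrite Rintegral_itvB ?bnd_simp// Rintegral_itv_obnd_cbnd//.
  apply: integrableS ig => //; apply: subset_itvr; rewrite bnd_simp//.
have key2 x y : (x = a \/ x = b \/ x = c) -> (y = a \/ y = b \/ y = c) ->
    ointr x y g = ointr m y g - ointr m x g.
  move=> hx hy; have mx : m <= x by case: hx => [|[]] ->.
  have my : m <= y by case: hy => [|[]] ->.
  have [xy|/ltW yx] := leP x y; first exact: key.
  by rewrite ointr_swap (key y x)// opprB.
rewrite (key2 a b) ?(key2 b c) ?(key2 a c); [ring|tauto..].
Qed.

Lemma ointrD a b g h :
  (forall t, between a b t -> {for t, continuous g}) ->
  (forall t, between a b t -> {for t, continuous h}) ->
  ointr a b (fun t => g t + h t) = ointr a b g + ointr a b h.
Proof.
wlog ab : a b / a <= b.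
  move=> W cg ch; have [/W->//|/ltW ba] := leP a b.
  rewrite ointr_swap W//; first by rewrite !(ointr_swap a b) opprD !opprK.
    by move=> t; rewrite betweenC; exact: cg.
  by move=> t; rewrite betweenC; exact: ch.
move=> cg ch; rewrite !ointr_le// RintegralD//; apply: continuous_integrable_itv.
  by move=> t tab; apply: cg; rewrite betweenP.
by move=> t tab; apply: ch; rewrite betweenP.
Qed.

Lemma ointrZ a b k g : (forall t, between a b t -> {for t, continuous g}) ->
  ointr a b (fun t => k * g t) = k * ointr a b g.
Proof.
wlog ab : a b / a <= b.
  move=> W cg; have [/W->//|/ltW ba] := leP a b.
  rewrite ointr_swap W//; first by rewrite !(ointr_swap a b) mulrN opprK.
  by move=> t; rewrite betweenC; exact: cg.
move=> cg; rewrite !ointr_le// RintegralZl//; apply: continuous_integrable_itv.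
by move=> t tab; apply: cg; rewrite betweenP.
Qed.

Lemma ointr_cst a b k : ointr a b (fun=> k) = (b - a) * k.
Proof.
wlog ab : a b / a <= b.
  move=> W; have [/W->//|/ltW ba] := leP a b.
  by rewrite ointr_swap W// -mulNr opprB.
rewrite ointr_le// Rintegral_cst//= mulrC lebesgue_measure_itv/= lte_fin.
by case: ltgtP ab => //= -> _; rewrite subrr.
Qed.

Lemma ointr_ge a b g h : a <= b ->
  (forall t, between a b t -> {for t, continuous g}) ->
  (forall t, between a b t -> {for t, continuous h}) ->
  (forall t, a <= t <= b -> g t <= h t) ->
  ointr a b g <= ointr a b h.
Proof.
move=> ab cg ch gh; rewrite !ointr_le//; apply: le_Rintegral => //.
- by apply: continuous_integrable_itv => t tab; apply: cg; rewrite betweenP.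
- by apply: continuous_integrable_itv => t tab; apply: ch; rewrite betweenP.
Qed.

Lemma ointr_bound a b g (M : R) :
  (forall t, between a b t -> {for t, continuous g}) ->
  (forall t, between a b t -> `|g t| <= M) ->
  `|ointr a b g| <= M * `|b - a|.
Proof.
wlog ab : a b / a <= b.
  move=> W cg gM; have [ab|/ltW ba] := leP a b; first exact: (W _ _ ab cg gM).
  rewrite ointr_swap normrN (distrC b a); apply: W => // t; rewrite betweenC.
    exact: cg.
  exact: gM.
move=> cg gM; rewrite (ger0_norm (_ : 0 <= b - a)) ?subr_ge0// mulrC -ointr_cst.
have cN : forall t, between a b t -> {for t, continuous (cst (- M) : R -> R)}.
  by move=> t _; exact: cst_continuous.
have cM : forall t, between a b t -> {for t, continuous (cst M : R -> R)}.
  by move=> t _; exact: cst_continuous.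
rewrite ler_norml -mulN1r -ointrZ//; apply/andP; split; apply: ointr_ge => //.
- by move=> t /cN; rewrite /cst mulN1r.
- by move=> t; rewrite -(betweenP _ ab) => /gM; rewrite mulN1r ler_norml => /andP[].
- by move=> t; rewrite -(betweenP _ ab) => /gM; rewrite ler_norml => /andP[].
Qed.

End oriented_integral.

Section complex_oriented_integral.
Variable R : realType.
Notation normc := (@Normc.normc R).
Implicit Types (a b c t : R) (g h : R -> R[i]).

(** Continuity at t, in the form in which the integrals of the real and
    imaginary parts consume it. *)
Definition pcont g t := {for t, continuous (fun s => complex.Re (g s))} /\
  {for t, continuous (fun s => complex.Im (g s))}.

Lemma pcont_eps g t :
  (forall e : R, 0 < e -> exists2 d, 0 < d & forall s : R, `|s - t| < d ->
     normc (g s - g t) < e) -> pcont g t.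
Proof.
move=> H; split; apply/cvgrPdist_lt => e /H[d d0 {}H];
  exists d => //= s; rewrite /ball_/= distrC => /H/(le_lt_trans _); apply.
- by rewrite distrC -raddfB normr_Re_le.
- by rewrite distrC -raddfB normr_Im_le.
Qed.

Lemma pcontD g h t : pcont g t -> pcont h t -> pcont (fun s => g s + h s) t.
Proof.
move=> [g1 g2] [h1 h2]; split.
- rewrite (_ : (fun _ => _) = (fun s => complex.Re (g s)) \+ (fun s => complex.Re (h s))).
    exact: continuousD.
  by apply/funext => s; rewrite raddfD.
- rewrite (_ : (fun _ => _) = (fun s => complex.Im (g s)) \+ (fun s => complex.Im (h s))).
    exact: continuousD.
  by apply/funext => s; rewrite raddfD.
Qed.

Lemma ReM (z w : R[i]) :
  complex.Re (z * w) = complex.Re z * complex.Re w - complex.Im z * complex.Im w.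
Proof. by case: z w => [? ?] [? ?]. Qed.

Lemma ImM (z w : R[i]) :
  complex.Im (z * w) = complex.Re z * complex.Im w + complex.Im z * complex.Re w.
Proof. by case: z w => [? ?] [? ?]. Qed.

Lemma pcontM g h t : pcont g t -> pcont h t -> pcont (fun s => g s * h s) t.
Proof.
move=> [g1 g2] [h1 h2]; split.
- rewrite (_ : (fun _ => _) = (fun s => complex.Re (g s) * complex.Re (h s)
     - complex.Im (g s) * complex.Im (h s))).
    by apply: continuousB; apply: continuousM.
  by apply/funext => s; rewrite ReM.
- rewrite (_ : (fun _ => _) = (fun s => complex.Re (g s) * complex.Im (h s)
     + complex.Im (g s) * complex.Re (h s))).
    by apply: continuousD; apply: continuousM.
  by apply/funext => s; rewrite ImM.
Qed.

Lemma pcont_cst (k : R[i]) t : pcont (fun=> k) t.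
Proof. by split; exact: cst_continuous. Qed.

Lemma pcontN g t : pcont g t -> pcont (fun s => - g s) t.
Proof.
move=> /(pcontM (pcont_cst (-1) t)).
by rewrite (_ : (fun s => -1 * g s) = (fun s => - g s))//;
  apply/funext => s; rewrite mulN1r.
Qed.

Lemma pcontB g h t : pcont g t -> pcont h t -> pcont (fun s => g s - h s) t.
Proof. by move=> cg /pcontN; exact: pcontD. Qed.

Lemma normc_continuous (h : R -> R[i]) t : pcont h t ->
  {for t, continuous (fun s => normc (h s))}.
Proof.
move=> [h1 h2]; rewrite (_ : (fun _ => _) = (fun s => Num.sqrt
  (complex.Re (h s) * complex.Re (h s) + complex.Im (h s) * complex.Im (h s)))).
  apply: continuous_comp; last exact: sqrt_continuous.
  by apply: continuousD; apply: continuousM.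
by apply/funext => s; case: (h s) => a b /=; rewrite !expr2.
Qed.

Definition oint a b g : R[i] :=
  ointr a b (fun t => complex.Re (g t)) +i* ointr a b (fun t => complex.Im (g t)).

Lemma oint_swap a b g : oint b a g = - oint a b g.
Proof. by rewrite /oint !(ointr_swap a b). Qed.

Lemma oint_chasles a b c g :
  (forall t, [|| between a b t, between b c t | between a c t] -> pcont g t) ->
  oint a b g + oint b c g = oint a c g.
Proof.
move=> cg; rewrite /oint/= -(@ointr_chasles _ a b c)//; last first.
  by move=> t /cg[].
by rewrite -(@ointr_chasles _ a b c _ (fun t th => (cg t th).2)).
Qed.

Lemma ointD a b g h :
  (forall t, between a b t -> pcont g t) -> (forall t, between a b t -> pcont h t) ->
  oint a b (fun t => g t + h t) = oint a b g + oint a b h.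
Proof.
move=> cg ch; rewrite /oint.
under [X in ointr _ _ X +i* _]eq_fun do rewrite raddfD/=.
under [X in _ +i* ointr _ _ X]eq_fun do rewrite raddfD/=.
rewrite (ointrD (fun t th => (cg t th).1) (fun t th => (ch t th).1)).
by rewrite (ointrD (fun t th => (cg t th).2) (fun t th => (ch t th).2)).
Qed.

Lemma ointZ a b (k : R[i]) g : (forall t, between a b t -> pcont g t) ->
  oint a b (fun t => k * g t) = k * oint a b g.
Proof.
move=> cg; rewrite /oint.
have c1 t (th : between a b t) := (cg t th).1.
have c2 t (th : between a b t) := (cg t th).2.
have cZ (x : R) (u : R -> R) : (forall t, between a b t -> {for t, continuous u}) ->
    forall t, between a b t -> {for t, continuous (fun s => x * u s)}.
  by move=> cu t th; apply: continuousM; [exact: cst_continuous|exact: cu].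
under [X in ointr _ _ X +i* _]eq_fun do rewrite ReM -mulNr.
under [X in _ +i* ointr _ _ X]eq_fun do rewrite ImM.
rewrite (ointrD (cZ _ _ c1) (cZ _ _ c2)) (ointrD (cZ _ _ c2) (cZ _ _ c1)).
rewrite (ointrZ _ c1) (ointrZ _ c2) (ointrZ _ c2) (ointrZ _ c1).
by case: (k) => x y /=; rewrite mulNr.
Qed.

Lemma ointB a b g h :
  (forall t, between a b t -> pcont g t) -> (forall t, between a b t -> pcont h t) ->
  oint a b (fun t => g t - h t) = oint a b g - oint a b h.
Proof.
move=> cg ch; rewrite ointD//; last by move=> t /ch; exact: pcontN.
congr (_ + _); rewrite -[RHS]mulN1r -ointZ//.
by congr (oint _ _ _); apply/funext => t; rewrite mulN1r.
Qed.

Lemma oint_cst a b (k : R[i]) : oint a b (fun=> k) = (b - a)%:C * k.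
Proof.
by rewrite /oint !ointr_cst; case: k => x y /=; simpc.
Qed.

Lemma eq_oint a b g h : (forall t, between a b t -> g t = h t) ->
  oint a b g = oint a b h.
Proof.
move=> gh; rewrite /oint /ointr; congr (_ +i* _); congr (_ - _);
  apply: eq_Rintegral => t; rewrite inE/= in_itv/= => tab;
  by rewrite gh// /between tab ?orbT.
Qed.

(** The factor 2 comes from estimating the real and imaginary parts
    separately. *)
Lemma oint_bound a b g (M : R) :
  (forall t, between a b t -> pcont g t) ->
  (forall t, between a b t -> normc (g t) <= M) ->
  normc (oint a b g) <= 2 * M * `|b - a|.
Proof.
move=> cg gM; rewrite (le_trans (normc_le_ReIm _))//=.
have h1 := ointr_bound (fun t th => (cg t th).1)
   (fun t th => le_trans (normr_Re_le _) (gM t th)).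
have h2 := ointr_bound (fun t th => (cg t th).2)
   (fun t th => le_trans (normr_Im_le _) (gM t th)).
by lra.
Qed.

End complex_oriented_integral.

(** * Goursat's theorem for rectangles *)

Section rectangles.
Variable R : realType.
Notation normc := (@Normc.normc R).
Implicit Types (a b c d s t : R) (f g : R[i] -> R[i]).

Lemma pcont_comp f (g : R -> R[i]) (K t : R) :
  (forall s, normc (g s - g t) <= K * `|s - t|) ->
  ccont f (g t) -> pcont (fun s => f (g s)) t.
Proof.
move=> gK cf; apply: pcont_eps => e /cf[d d0 H].
have K0 : 0 < `|K| + 1 by have := normr_ge0 K; lra.
exists (d / (`|K| + 1)); first by rewrite divr_gt0.
move=> s; rewrite ltr_pdivlMr// => sd; apply: H.
rewrite (le_lt_trans (gK s))// (le_lt_trans _ sd)// mulrC ler_wpM2l//.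
by have := ler_norm K; lra.
Qed.

Lemma pcont_hor f (x y : R) : ccont f (x +i* y) -> pcont (fun s => f (s +i* y)) x.
Proof.
apply: (@pcont_comp _ (fun s => s +i* y) 1) => s; rewrite mul1r.
by rewrite (le_trans (normc_le_ReIm _))//= subrr normr0 addr0.
Qed.

Lemma pcont_ver f (x y : R) : ccont f (x +i* y) -> pcont (fun s => f (x +i* s)) y.
Proof.
apply: (@pcont_comp _ (fun s => x +i* s) 1) => s; rewrite mul1r.
by rewrite (le_trans (normc_le_ReIm _))//= subrr normr0 add0r.
Qed.

(** The integral of f around the rectangle [a, b] x [c, d].  Opposite sides are
    grouped under one integral, which makes the integrals of affine functions
    vanish without any antiderivative. *)
Definition rect f a b c d : R[i] :=
  oint a b (fun s => f (s +i* c) - f (s +i* d)) +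
  'i%C * oint c d (fun t => f (b +i* t) - f (a +i* t)).

Definition ccont_rect f a b c d :=
  forall s t, between a b s -> between c d t -> ccont f (s +i* t).

Lemma between_l a b : between a b a. Proof. by rewrite /between lexx/= andbT le_total. Qed.

Lemma between_r a b : between a b b. Proof. by rewrite betweenC between_l. Qed.

Lemma pcont_diff_hor f a b c d t : ccont_rect f a b c d -> between a b t ->
  pcont (fun s => f (s +i* c) - f (s +i* d)) t.
Proof.
by move=> cf tab; apply: pcontB; apply: pcont_hor; apply: cf => //;
  rewrite ?between_l ?between_r.
Qed.

Lemma pcont_diff_ver f a b c d t : ccont_rect f a b c d -> between c d t ->
  pcont (fun t => f (b +i* t) - f (a +i* t)) t.
Proof.
by move=> cf tab; apply: pcontB; apply: pcont_ver; apply: cf => //;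
  rewrite ?between_l ?between_r.
Qed.

Lemma ccont_rect_sub f a b c d a' b' c' d' :
  a <= a' -> a' <= b' -> b' <= b -> c <= c' -> c' <= d' -> d' <= d ->
  ccont_rect f a b c d -> ccont_rect f a' b' c' d'.
Proof.
move=> aa ab bb cc cd dd cf s t; rewrite !betweenP// => /andP[? ?] /andP[? ?].
by apply: cf; rewrite betweenP; lra.
Qed.

Lemma rect_splitx f a m b c d : a <= m -> m <= b -> c <= d ->
  ccont_rect f a b c d ->
  rect f a b c d = rect f a m c d + rect f m b c d.
Proof.
move=> am mb cd cf; rewrite /rect.
have cf1 : ccont_rect f a m c d by apply: ccont_rect_sub cf.
have cf2 : ccont_rect f m b c d by apply: ccont_rect_sub cf.
rewrite -(@oint_chasles _ a m b); last first.
  move=> t ht; apply: (pcont_diff_hor cf).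
  by move: ht; rewrite (betweenP _ am) (betweenP _ mb) !(betweenP _ (le_trans am mb)) =>
    /or3P[] /andP[? ?]; lra.
have E : oint c d (fun t => f (b +i* t) - f (a +i* t)) =
   oint c d (fun t => f (b +i* t) - f (m +i* t)) +
   oint c d (fun t => f (m +i* t) - f (a +i* t)).
  rewrite -ointD; first by apply: eq_oint => t _; ring.
    by move=> t; apply: pcont_diff_ver cf2.
  by move=> t; apply: pcont_diff_ver cf1.
rewrite E; ring.
Qed.

Lemma rect_splity f a b c m d : a <= b -> c <= m -> m <= d ->
  ccont_rect f a b c d ->
  rect f a b c d = rect f a b c m + rect f a b m d.
Proof.
move=> ab cm md cf; rewrite /rect.
have cf1 : ccont_rect f a b c m by apply: ccont_rect_sub cf.
have cf2 : ccont_rect f a b m d by apply: ccont_rect_sub cf.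
rewrite -(@oint_chasles _ c m d); last first.
  move=> t ht; apply: (pcont_diff_ver cf).
  by move: ht; rewrite (betweenP _ cm) (betweenP _ md) !(betweenP _ (le_trans cm md)) =>
    /or3P[] /andP[? ?]; lra.
have E : oint a b (fun s => f (s +i* c) - f (s +i* d)) =
   oint a b (fun s => f (s +i* c) - f (s +i* m)) +
   oint a b (fun s => f (s +i* m) - f (s +i* d)).
  rewrite -ointD; first by apply: eq_oint => t _; ring.
    by move=> t; apply: pcont_diff_hor cf1.
  by move=> t; apply: pcont_diff_hor cf2.
rewrite E; ring.
Qed.

Lemma rect_bound f a b c d (M : R) : a <= b -> c <= d -> ccont_rect f a b c d ->
  (forall s t, a <= s <= b -> c <= t <= d -> normc (f (s +i* t)) <= M) ->
  normc (rect f a b c d) <= 4 * M * ((b - a) + (d - c)).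
Proof.
move=> ab cd cf fM.
rewrite (le_trans (normc_triangle _ _))// Normc.normcM normc_i mul1r.
have B z w : normc z <= M -> normc w <= M -> normc (z - w) <= 2 * M.
  move=> zM wM; rewrite (le_trans (normc_triangle _ _))// normc_opp; lra.
have cc : c <= c <= d by lra.
have cdd : c <= d <= d by lra.
have aa : a <= a <= b by lra.
have bb : a <= b <= b by lra.
have h1 : normc (oint a b (fun s => f (s +i* c) - f (s +i* d))) <=
    2 * (2 * M) * `|b - a|.
  apply: oint_bound => t; first exact: pcont_diff_hor cf.
  by rewrite betweenP// => tab; apply: B; apply: fM.
have h2 : normc (oint c d (fun t => f (b +i* t) - f (a +i* t))) <=
    2 * (2 * M) * `|d - c|.
  apply: oint_bound => t; first exact: pcont_diff_ver cf.
  by rewrite betweenP// => tab; apply: B; apply: fM.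
move: h1 h2; rewrite !ger0_norm ?subr_ge0//; lra.
Qed.

Lemma rectB f g a b c d : ccont_rect f a b c d -> ccont_rect g a b c d ->
  rect (fun z => f z - g z) a b c d = rect f a b c d - rect g a b c d.
Proof.
move=> cf cg; rewrite /rect opprD addrACA -mulrBr -!ointB; last 4 first.
- by move=> t; apply: pcont_diff_ver cf.
- by move=> t; apply: pcont_diff_ver cg.
- by move=> t; apply: pcont_diff_hor cf.
- by move=> t; apply: pcont_diff_hor cg.
by congr (_ + 'i%C * _); apply: eq_oint => t _; ring.
Qed.

(** On opposite sides an affine function differs by a constant, and the two
    constants cancel. *)
Lemma rect_affine (k l : R[i]) a b c d :
  rect (fun z => k + l * z) a b c d = 0.
Proof.
rewrite /rect.
under eq_oint => s _.
  rewrite (_ : _ - _ = l * (0 +i* (c - d))); last first.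
    rewrite opprD addrACA subrr add0r -mulrBr; congr (_ * _).
    by apply/eqP; rewrite eq_complex/= subrr !eqxx.
  over.
under [X in _ + _ * X]eq_oint => t _.
  rewrite (_ : _ - _ = l * ((b - a) +i* 0)); last first.
    rewrite opprD addrACA subrr add0r -mulrBr; congr (_ * _).
    by apply/eqP; rewrite eq_complex/= subrr !eqxx.
  over.
rewrite !oint_cst !(mulrCA _ l) -mulrDr [X in l * X](_ : _ = 0) ?mulr0//.
by apply/eqP; rewrite eq_complex/=; apply/andP; split; apply/eqP; ring.
Qed.

Lemma four_max (N x y z t : R) : N <= x + y + (z + t) ->
  [\/ N <= 4 * x, N <= 4 * y, N <= 4 * z | N <= 4 * t].
Proof.
move=> le.
have [?|?] := leP N (4 * x); first exact: Or41.
have [?|?] := leP N (4 * y); first exact: Or42.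
have [?|?] := leP N (4 * z); first exact: Or43.
by apply: Or44; lra.
Qed.

(** The bisection step: one of the four quarters carries at least a quarter of
    the integral. *)
Lemma rect_quarter f (x y h k : R) : 0 <= h -> 0 <= k ->
  ccont_rect f x (x + 2 * h) y (y + 2 * k) ->
  exists q : R * R, [/\ x <= q.1 <= x + h, y <= q.2 <= y + k &
    normc (rect f x (x + 2 * h) y (y + 2 * k)) <=
    4 * normc (rect f q.1 (q.1 + h) q.2 (q.2 + k))].
Proof.
move=> h0 k0 cf.
rewrite (@rect_splitx f x (x + h)); [|lra..|by[]].
rewrite (@rect_splity f x (x + h) y (y + k)); [|lra..|]; last first.
  by apply: ccont_rect_sub cf; lra.
rewrite (@rect_splity f (x + h) _ y (y + k)); [|lra..|]; last first.
  by apply: ccont_rect_sub cf; lra.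
rewrite (_ : x + 2 * h = x + h + h); last by ring.
rewrite (_ : y + 2 * k = y + k + k); last by ring.
set r1 := rect _ _ _ _ _; set r2 := rect _ _ _ _ _; set r3 := rect _ _ _ _ _.
set r4 := rect _ _ _ _ _.
have T : normc (r1 + r2 + (r3 + r4)) <= normc r1 + normc r2 + (normc r3 + normc r4).
  by rewrite (le_trans (normc_triangle _ _))// lerD// normc_triangle.
set N := normc _ in T *.
have bx (p : R * R) (N' : R) : x <= p.1 -> p.1 <= x + h -> y <= p.2 ->
    p.2 <= y + k -> N <= N' ->
    [/\ x <= p.1 <= x + h, y <= p.2 <= y + k & N <= N'].
  by move=> -> -> -> ->.
have xh : x <= x + h by rewrite lerDl.
have yk : y <= y + k by rewrite lerDl.
case: (four_max T) => H; [exists (x, y)|exists (x, y + k)|exists (x + h, y)|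
  exists (x + h, y + k)]; exact: bx.
Qed.

(** If the integral were K > 0 in modulus, repeated quartering would give
    rectangles of sides (b - a) / 2^n and (d - c) / 2^n with integrals at least
    K / 4^n.  They shrink to a point at which f is affine up to e times the
    distance, and affine functions do not contribute, so these integrals are
    also at most a constant times e / 4^n. *)
Theorem goursat f a b c d : a <= b -> c <= d ->
  (forall s t, a <= s <= b -> c <= t <= d -> exists l, cderiv f (s +i* t) l) ->
  rect f a b c d = 0.
Proof.
move=> ab cd df.
have cf : ccont_rect f a b c d.
  move=> s t; rewrite !betweenP// => sab tcd.
  by have [l /cderiv_ccont] := df _ _ sab tcd.
apply/eqP; rewrite -normc_eq0 eq_le normc_ge0 andbT leNgt; apply/negP => K0.
set K := normc _ in K0.
pose A := b - a; pose B := d - c.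
have A0 : 0 <= A by rewrite /A; lra.
have B0 : 0 <= B by rewrite /B; lra.
(* u n = 2^-n is the scale of the n-th rectangle, whose lower left corner is
   P n below. *)
pose u (n : nat) : R := 2^-1 ^+ n.
have u0 n : 0 < u n by rewrite exprn_gt0// invr_gt0.
have uS n : u n = 2 * u n.+1 by rewrite /u exprS mulrA divff// mul1r.
have u00 : u 0%N = 1 by rewrite /u expr0.
pose ok n (p : R * R) := [/\ a <= p.1, p.1 + A * u n <= b,
   c <= p.2 & p.2 + B * u n <= d].
pose G n (p : R * R) := normc (rect f p.1 (p.1 + A * u n) p.2 (p.2 + B * u n)).
have step : forall np : nat * (R * R), exists q : R * R, ok np.1 np.2 ->
    [/\ np.2.1 <= q.1 <= np.2.1 + A * u np.1.+1,
        np.2.2 <= q.2 <= np.2.2 + B * u np.1.+1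
      & G np.1 np.2 <= 4 * G np.1.+1 q].
  move=> [n [x y]] /=.
  have [[/= ax xb cy yd]|nok] := pselect (ok n (x, y)); last by exists (0, 0).
  have Au : 0 <= A * u n.+1 by rewrite mulr_ge0// ltW.
  have Bu : 0 <= B * u n.+1 by rewrite mulr_ge0// ltW.
  have EA : 2 * (A * u n.+1) = A * u n by rewrite (uS n); ring.
  have EB : 2 * (B * u n.+1) = B * u n by rewrite (uS n); ring.
  have := @rect_quarter f x y _ _ Au Bu; rewrite EA EB.
  case=> [|q [q1 q2 q3]]; last by exists q => _; split.
  by apply: ccont_rect_sub cf; lra.
have [nxt nxtP] := choice step.
pose P := fix P n := if n is m.+1 then nxt (m, P m) else (a, c).
have okP n : ok n (P n).
  elim: n => [|n IH]; first by split; rewrite /= ?u00 ?mulr1 /A /B; lra.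
  have [/= /andP[h1 h2] /andP[h3 h4] _] := nxtP (n, P n) IH.
  case: IH => k1 k2 k3 k4; rewrite (uS n) in k2 k4.
  by split => /=; lra.
have PS n := nxtP (n, P n) (okP n).
have p4 n : 0 <= (4 : R) ^+ n by rewrite exprn_ge0.
have GP n : K <= 4 ^+ n * G n (P n).
  elim: n => [|n IH].
    by rewrite expr0 mul1r /G [P 0%N]/= /= u00 !mulr1 /A /B !subrKC.
  have [_ _ /=] := PS n.
  rewrite exprSr -mulrA => h.
  exact: (le_trans IH (ler_wpM2l (p4 n) h)).
have mono n m : (P n).1 <= (P (n + m)%N).1 /\
   (P (n + m)%N).1 + A * u (n + m)%N <= (P n).1 + A * u n /\
   (P n).2 <= (P (n + m)%N).2 /\
   (P (n + m)%N).2 + B * u (n + m)%N <= (P n).2 + B * u n.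
  elim: m => [|m [h1 [h2 [h3 h4]]]]; first by rewrite addn0.
  have [] := PS (n + m)%N; rewrite (uS (n + m)%N) in h2 h4.
  by rewrite addnS /= => /andP[k1 k2] /andP[k3 k4] _; repeat split; lra.
have Au n : 0 <= A * u n by rewrite mulr_ge0// ltW.
have Bu n : 0 <= B * u n by rewrite mulr_ge0// ltW.
have mono2 n m : (P m).1 <= (P n).1 + A * u n /\ (P m).2 <= (P n).2 + B * u n.
  have [h1 [h2 [h3 h4]]] := mono n m; have [k1 [k2 [k3 k4]]] := mono m n.
  rewrite addnC in k1 k2 k3 k4.
  by have := Au (n + m)%N; have := Bu (n + m)%N; split; lra.
(* The corners increase in both coordinates, so their suprema are the
   coordinates of the common point of all rectangles. *)
pose X := [set (P n).1 | n in setT]; pose Y := [set (P n).2 | n in setT].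
have Xsup n : (P n).1 <= sup X /\ sup X <= (P n).1 + A * u n.
  have ubX : ubound X ((P n).1 + A * u n) by move=> _ [m _ <-]; have [] := mono2 n m.
  split; last by apply: ge_sup => //; exists (P n).1; exists n.
  by apply: ub_le_sup; [exists ((P n).1 + A * u n)|exists n].
have Ysup n : (P n).2 <= sup Y /\ sup Y <= (P n).2 + B * u n.
  have ubY : ubound Y ((P n).2 + B * u n) by move=> _ [m _ <-]; have [] := mono2 n m.
  split; last by apply: ge_sup => //; exists (P n).2; exists n.
  by apply: ub_le_sup; [exists ((P n).2 + B * u n)|exists n].
have [l fl] : exists l, cderiv f (sup X +i* sup Y) l.
  have [h1 h2] := Xsup 0%N; have [h3 h4] := Ysup 0%N; have [k1 k2 k3 k4] := okP 0%N.
  by apply: df; lra.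
set w := sup X +i* sup Y in fl.
(* e is such that the final estimate 4 e (A + B)^2 = e (L - 1) is < K. *)
pose L := (A + B) ^+ 2 * 4 + 1.
have L0 : 0 < L by rewrite /L; have := sqr_ge0 (A + B); lra.
pose e := K / 2 / L.
have e0 : 0 < e by rewrite /e !divr_gt0.
have [r r0 H] := fl _ e0.
have [n nr] : exists n, (A + B) * u n < r.
  have AB : 0 < A + B + 1 by lra.
  have r1 : 0 < r / (A + B + 1) by rewrite divr_gt0.
  have := @cvg_expr R 2^-1; rewrite ger0_norm ?invr_ge0// invf_lt1// ltr1n.
  move=> /(_ isT)/cvgrPdist_lt/(_ _ r1)[N _ /(_ N (leqnn N))].
  rewrite /= sub0r normrN ger0_norm -/(u N); last exact: ltW.
  rewrite ltr_pdivlMr// => h; exists N; have := u0 N; lra.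
set x := (P n).1; set y := (P n).2.
have [X1 X2] := Xsup n; have [Y1 Y2] := Ysup n; rewrite -/x -/y in X1 X2 Y1 Y2.
pose g z := (f w - l * w) + l * z.
have cg s t : ccont g (s +i* t).
  apply: (@cderiv_ccont _ _ _ l) => e' e'0; exists 1 => // h _.
  by rewrite (_ : _ - _ - _ = 0) ?Normc.normc0 ?mulr_ge0 ?normc_ge0 ?ltW// /g; ring.
have [k1 k2 k3 k4] := okP n.
have cfn : ccont_rect f x (x + A * u n) y (y + B * u n).
  have := Au n; have := Bu n => *.
  by apply: ccont_rect_sub cf; rewrite ?/x ?/y; lra.
have En : normc (rect f x (x + A * u n) y (y + B * u n)) <=
    4 * (e * ((A + B) * u n)) * (A * u n + B * u n).
  have -> : rect f x (x + A * u n) y (y + B * u n) =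
     rect (fun z => f z - g z) x (x + A * u n) y (y + B * u n).
    by rewrite rectB// rect_affine subr0.
  have := Au n; have := Bu n => Bn An.
  have -> : A * u n + B * u n = (x + A * u n - x) + (y + B * u n - y) by ring.
  apply: rect_bound; [lra|lra| |].
  - move=> s t hs ht e' e'0.
    have [d1 d10 D1] := cfn s t hs ht _ (divr_gt0 e'0 (ltr0n R 2)).
    have [d2 d20 D2] := cg s t _ (divr_gt0 e'0 (ltr0n R 2)).
    exists (Num.min d1 d2); first by rewrite lt_min d10.
    move=> v; rewrite lt_min => /andP[/D1 {}D1 /D2 {}D2].
    have -> : f v - g v - (f (s +i* t) - g (s +i* t)) =
       (f v - f (s +i* t)) - (g v - g (s +i* t)) by ring.
    by rewrite (le_lt_trans (normc_triangle _ _))// normc_opp; lra.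
  - move=> s t hs ht.
    have D : normc (s +i* t - w) <= (A + B) * u n.
      rewrite (le_trans (normc_le_ReIm _))//= mulrDl lerD// ler_norml; lra.
    have := H (s +i* t - w) (le_lt_trans D nr).
    rewrite (addrC w) subrK => h.
    rewrite (_ : f (s +i* t) - g (s +i* t) =
      f (s +i* t) - f w - l * (s +i* t - w)); last by rewrite /g; ring.
    by rewrite (le_trans h)// ler_wpM2l// ltW.
have := GP n; rewrite leNgt => /negP; apply.
have u4 : 4 ^+ n * (u n * u n) = 1.
  rewrite /u -exprMn -exprMn (_ : 4 * _ = 1) ?expr1n//.
  by rewrite -invfM -natrM divff.
have : 4 ^+ n * G n (P n) <= 4 ^+ n * (4 * (e * ((A + B) * u n)) * (A * u n + B * u n)).
  exact: (ler_wpM2l (p4 n) En).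
rewrite (_ : 4 ^+ n * (4 * _ * _) = 4 ^+ n * (u n * u n) * (e * (L - 1))); last first.
  by rewrite /L; ring.
rewrite u4 mul1r => /le_lt_trans; apply.
have -> : e * (L - 1) = e * L - e by ring.
by rewrite /e divfK ?gt_eqF//; rewrite /e in e0; lra.
Qed.

End rectangles.

(** * Primitives on the half-plane and removable points *)

Section primitive.
Variable R : realType.
Notation normc := (@Normc.normc R).
Implicit Types (a b c d s t : R) (f g : R[i] -> R[i]).

Lemma rect_swapx f a b c d : ccont_rect f a b c d ->
  rect f b a c d = - rect f a b c d.
Proof.
move=> cf; rewrite /rect oint_swap opprD -mulrN; congr (_ + 'i%C * _).
rewrite -[RHS]mulN1r -ointZ; first by apply: eq_oint => t _; ring.
by move=> t; apply: pcont_diff_ver cf.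
Qed.

Lemma rect_swapy f a b c d : ccont_rect f a b c d ->
  rect f a b d c = - rect f a b c d.
Proof.
move=> cf; rewrite /rect (oint_swap c d) opprD -mulrN; congr (_ + _).
rewrite -[RHS]mulN1r -ointZ; first by apply: eq_oint => t _; ring.
by move=> t; apply: pcont_diff_hor cf.
Qed.

Lemma goursat_oriented f a b c d :
  (forall s t, between a b s -> between c d t -> exists l, cderiv f (s +i* t) l) ->
  rect f a b c d = 0.
Proof.
move=> df.
have cf : ccont_rect f a b c d.
  by move=> s t hs ht; have [l /cderiv_ccont] := df _ _ hs ht.
wlog ab : a b df cf / a <= b.
  move=> W; have [/W|/ltW ba] := leP a b; first exact.
  apply/eqP; rewrite -oppr_eq0 -rect_swapx// W// => s t.
    by rewrite betweenC; exact: df.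
  by rewrite betweenC; exact: cf.
wlog cd : c d df cf / c <= d.
  move=> W; have [/W|/ltW dc] := leP c d; first exact.
  apply/eqP; rewrite -oppr_eq0 -rect_swapy// W// => s t hs.
    by rewrite betweenC; exact: df.
  by rewrite betweenC; exact: cf.
by apply: goursat => // s t hs ht; apply: df; rewrite betweenP.
Qed.

(** The path goes from i horizontally, then vertically to z. *)
Definition primitive f (z : R[i]) : R[i] :=
  oint 0 (complex.Re z) (fun s => f (s +i* 1)) +
  'i%C * oint 1 (complex.Im z) (fun t => f (complex.Re z +i* t)).

Definition differentiable_uhp f :=
  forall x y : R, 0 < y -> exists l, cderiv f (x +i* y) l.

Lemma between_gt0 a b t : 0 < a -> 0 < b -> between a b t -> 0 < t.
Proof. by move=> a0 b0 /orP[] /andP[? ?]; lra. Qed.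

Section primitive_uhp.
Variable f : R[i] -> R[i].
Hypothesis df : differentiable_uhp f.

Lemma ccont_differentiable_uhp x y : 0 < y -> ccont f (x +i* y).
Proof. by move=> /(df x)[l /cderiv_ccont]. Qed.

(** The two staircase paths to z' differ by the boundary of a rectangle. *)
Lemma primitive_increment x y x' y' : 0 < y -> 0 < y' ->
  primitive f (x' +i* y') - primitive f (x +i* y) =
  oint x x' (fun s => f (s +i* y)) + 'i%C * oint y y' (fun t => f (x' +i* t)).
Proof.
move=> y0 y'0; rewrite /primitive/=.
have ch u s : 0 < u -> pcont (fun s => f (s +i* u)) s.
  by move=> u0; apply: pcont_hor; exact: ccont_differentiable_uhp.
have cv u t : 0 < t -> pcont (fun s => f (u +i* s)) t.
  by move=> u0; apply: pcont_ver; exact: ccont_differentiable_uhp.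
rewrite -(@oint_chasles _ 0 x x'); last by move=> t _; apply: ch.
rewrite -(@oint_chasles _ 1 y y'); last first.
  by move=> t /or3P[] /between_gt0 ht; apply: cv; apply: ht.
have : rect f x x' 1 y = 0.
  by apply: goursat_oriented => s t _ /between_gt0 ht; apply: df; exact: ht.
rewrite /rect ointB; last 2 first.
- by move=> t _; apply: ch.
- by move=> t _; apply: ch.
rewrite ointB; last 2 first.
- by move=> t /between_gt0 ht; apply: cv; apply: ht.
- by move=> t /between_gt0 ht; apply: cv; apply: ht.
by move=> /eqP; rewrite addrAC subr_eq0 => /eqP <-; ring.
Qed.

Lemma cderiv_primitive x y : 0 < y ->
  cderiv (primitive f) (x +i* y) (f (x +i* y)).
Proof.
move=> y0 e e0; have e4 : 0 < e / 4 by rewrite divr_gt0.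
have [d d0 H] := ccont_differentiable_uhp x y0 e4.
exists (Num.min y (d / 2)); first by rewrite lt_min y0 divr_gt0.
case=> h k; rewrite lt_min => /andP[hy hd].
have kn : `|k| <= normc (h +i* k) := normr_Im_le (h +i* k).
have hn : `|h| <= normc (h +i* k) := normr_Re_le (h +i* k).
set n := normc (h +i* k) in hy hd kn hn *; clearbody n.
have k1 : - n <= k by move: kn; rewrite ler_norml => /andP[].
have yk : 0 < y + k by lra.
have ch u s : 0 < u -> pcont (fun s => f (s +i* u)) s.
  by move=> u0; apply: pcont_hor; exact: ccont_differentiable_uhp.
have cv u t : 0 < t -> pcont (fun s => f (u +i* s)) t.
  by move=> u0; apply: pcont_ver; exact: ccont_differentiable_uhp.
have -> : primitive f (x +i* y + (h +i* k)) - primitive f (x +i* y)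
    - f (x +i* y) * (h +i* k) =
  oint x (x + h) (fun s => f (s +i* y) - f (x +i* y)) +
  'i%C * oint y (y + k) (fun t => f ((x + h) +i* t) - f (x +i* y)).
  rewrite (primitive_increment x (x + h) y0 yk) !ointB; last 4 first.
  - by move=> t /between_gt0 ht; apply: cv; apply: ht.
  - by move=> t _; exact: pcont_cst.
  - by move=> t _; apply: ch.
  - by move=> t _; exact: pcont_cst.
  rewrite !oint_cst.
  have -> : h +i* k = h%:C + 'i%C * k%:C by simpc.
  rewrite (_ : x + h - x = h); last by ring.
  rewrite (_ : y + k - y = k); last by ring.
  by ring.
have near s t : `|s - x| <= `|h| -> `|t - y| <= `|k| ->
    normc (f (s +i* t) - f (x +i* y)) <= e / 4.
  move=> sx ty; apply/ltW/H; rewrite (le_lt_trans (normc_le_ReIm _))//=.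
  by lra.
have b1 : normc (oint x (x + h) (fun s => f (s +i* y) - f (x +i* y)))
    <= 2 * (e / 4) * `|x + h - x|.
  apply: oint_bound => t.
    by move=> _; apply: pcontB; [exact: ch|exact: pcont_cst].
  move=> ht; apply: near; last by rewrite subrr normr0.
  by rewrite ler_norml; case/orP: ht => /andP[? ?]; have := ler_norm h;
    have := ler_norm (- h); rewrite normrN; lra.
have b2 : normc (oint y (y + k) (fun t => f ((x + h) +i* t) - f (x +i* y)))
    <= 2 * (e / 4) * `|y + k - y|.
  apply: oint_bound => t.
    by move=> /between_gt0 ht; apply: pcontB; [exact/cv/ht|exact: pcont_cst].
  move=> ht; apply: near; first by rewrite addrC addKr.
  by rewrite ler_norml; case/orP: ht => /andP[? ?]; have := ler_norm k;
    have := ler_norm (- k); rewrite normrN; lra.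
rewrite (le_trans (normc_triangle _ _))// Normc.normcM normc_i mul1r.
have Eh : x + h - x = h by ring.
have Ek : y + k - y = k by ring.
rewrite Eh in b1; rewrite Ek in b2.
by have := ler_wpM2l (ltW e4) hn; have := ler_wpM2l (ltW e4) kn; lra.
Qed.

End primitive_uhp.

End primitive.

Section cauchy_estimate.
Variable R : realType.
Notation normc := (@Normc.normc R).
Implicit Types (a b c d s t : R) (f g : R[i] -> R[i]).

(** A rectangle around the exceptional point is cut into a small square
    centred there and pieces on which Goursat's theorem applies; on the square
    f is bounded and the perimeter is arbitrarily small. *)
Lemma goursat_point f a m b c n d : a < m < b -> c < n < d ->
  ccont_rect f a b c d ->
  (forall s t, a <= s <= b -> c <= t <= d -> s +i* t != m +i* n ->
    exists l, cderiv f (s +i* t) l) ->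
  rect f a b c d = 0.
Proof.
move=> /andP[am mb] /andP[cn nd] cf df.
apply/eqP; rewrite -normc_eq0 eq_le normc_ge0 andbT leNgt; apply/negP => K0.
set K := normc _ in K0.
have [r r0 H] : exists2 d, 0 < d & forall w, normc (w - (m +i* n)) < d ->
    normc (f w - f (m +i* n)) < 1.
  by apply: cf => //; rewrite betweenP; lra.
pose M := normc (f (m +i* n)) + 1.
have M0 : 0 < M by rewrite /M; have := normc_ge0 (f (m +i* n)); lra.
(* e is the half-side of the small square: it must fit in the rectangle, stay
   in the ball where |f| <= M, and satisfy 16 M e < K. *)
pose e := Num.min (Num.min (Num.min (m - a) (b - m)) (Num.min (n - c) (d - n)))
  (Num.min (r / 3) (K / (17 * M))).
have : e <= e by [].
rewrite {2}/e !le_min -!andbA => /and5P[e1 e2 e3 e4 /andP[e5 e6]].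
have e0 : 0 < e.
  rewrite /e !lt_min !divr_gt0 ?mulr_gt0// !andbT; lra.
have Z a' b' c' d' : a <= a' -> a' <= b' -> b' <= b -> c <= c' -> c' <= d' ->
    d' <= d -> (forall s t, a' <= s <= b' -> c' <= t <= d' ->
       s +i* t != m +i* n) -> rect f a' b' c' d' = 0.
  move=> *; apply: goursat => // s t hs ht; apply: df; [lra|lra|].
  by auto.
have ne1 s t : s != m -> s +i* t != m +i* n.
  by apply: contra => /eqP[-> _].
have ne2 s t : t != n -> s +i* t != m +i* n.
  by apply: contra => /eqP[_ ->].
have E : rect f a b c d = rect f (m - e) (m + e) (n - e) (n + e).
  rewrite (@rect_splitx _ f a (m - e)); [|lra..|by[]].
  rewrite (Z a (m - e)); [|lra..|]; last first.
    by move=> s t hs _; apply: ne1; rewrite lt_eqF//; lra.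
  rewrite (@rect_splitx _ f (m - e) (m + e)); [|lra..|]; last first.
    by apply: ccont_rect_sub cf; lra.
  rewrite (Z (m + e) b); [|lra..|]; last first.
    by move=> s t hs _; apply: ne1; rewrite gt_eqF//; lra.
  rewrite (@rect_splity _ f _ _ c (n - e)); [|lra..|]; last first.
    by apply: ccont_rect_sub cf; lra.
  rewrite (Z _ _ c (n - e)); [|lra..|]; last first.
    by move=> s t _ hs; apply: ne2; rewrite lt_eqF//; lra.
  rewrite (@rect_splity _ f _ _ (n - e) (n + e)); [|lra..|]; last first.
    by apply: ccont_rect_sub cf; lra.
  rewrite (Z _ _ (n + e) d); [|lra..|]; last first.
    by move=> s t _ hs; apply: ne2; rewrite gt_eqF//; lra.
  by ring.
have : K <= 4 * M * ((m + e - (m - e)) + (n + e - (n - e))).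
  rewrite /K E; apply: rect_bound; [lra|lra| |].
    by apply: ccont_rect_sub cf; lra.
  move=> s t hs ht.
  have := H (s +i* t); rewrite (le_lt_trans (normc_le_ReIm _))//=; last first.
    have : `|s - m| <= e by rewrite ler_norml; lra.
    have : `|t - n| <= e by rewrite ler_norml; lra.
    lra.
  by move=> /(_ isT); have := lenormcB (f (s +i* t)) (f (m +i* n)); rewrite /M; lra.
move: e6; rewrite ler_pdivlMr ?mulr_gt0//; nra.
Qed.

(** Continuity on the boundary only: linearity of the boundary integral must
    apply to functions with a pole inside. *)
Definition ccont_sides f a b c d :=
  [/\ forall s, between a b s -> ccont f (s +i* c),
      forall s, between a b s -> ccont f (s +i* d),
      forall t, between c d t -> ccont f (a +i* t) &
      forall t, between c d t -> ccont f (b +i* t)].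

Lemma rect_linear f g (k : R[i]) a b c d :
  ccont_sides f a b c d -> ccont_sides g a b c d ->
  rect (fun z => f z - k * g z) a b c d = rect f a b c d - k * rect g a b c d.
Proof.
move=> [f1 f2 f3 f4] [g1 g2 g3 g4]; rewrite /rect.
have pf1 t : between a b t -> pcont (fun s => f (s +i* c) - f (s +i* d)) t.
  by move=> h; apply: pcontB; apply: pcont_hor; [exact: f1|exact: f2].
have pg1 t : between a b t -> pcont (fun s => g (s +i* c) - g (s +i* d)) t.
  by move=> h; apply: pcontB; apply: pcont_hor; [exact: g1|exact: g2].
have pf2 t : between c d t -> pcont (fun t => f (b +i* t) - f (a +i* t)) t.
  by move=> h; apply: pcontB; apply: pcont_ver; [exact: f4|exact: f3].
have pg2 t : between c d t -> pcont (fun t => g (b +i* t) - g (a +i* t)) t.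
  by move=> h; apply: pcontB; apply: pcont_ver; [exact: g4|exact: g3].
have lin a' b' (u v : R -> R[i]) : (forall t, between a' b' t -> pcont u t) ->
    (forall t, between a' b' t -> pcont v t) ->
    oint a' b' (fun t => u t - k * v t) = oint a' b' u - k * oint a' b' v.
  move=> cu cv; rewrite ointB// ?ointZ// => t h.
  by apply: pcontM; [exact: pcont_cst|exact: cv].
rewrite [RHS](_ : _ = (oint a b (fun s => f (s +i* c) - f (s +i* d)) -
    k * oint a b (fun s => g (s +i* c) - g (s +i* d))) + 'i%C *
   (oint c d (fun t => f (b +i* t) - f (a +i* t)) -
    k * oint c d (fun t => g (b +i* t) - g (a +i* t)))); last by ring.
rewrite -!lin//.
by congr (_ + 'i%C * _); apply: eq_oint => t _; ring.
Qed.

End cauchy_estimate.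

(** * Cauchy's estimate on a square *)

Section cauchy_square.
Variable R : realType.
Notation normc := (@Normc.normc R).
Notation mu := (@lebesgue_measure R).
Implicit Types (a b c d s t : R) (f g : R[i] -> R[i]).

Lemma oint_norm a b (g : R -> R[i]) (u : R -> R) : a <= b ->
  (forall t, between a b t -> pcont g t) ->
  (forall t, between a b t -> {for t, continuous u}) ->
  (forall t, a <= t <= b -> normc (g t) <= u t) ->
  normc (oint a b g) <= 2 * ointr a b u.
Proof.
move=> ab cg cu gu; rewrite (le_trans (normc_le_ReIm _))//=.
have cNu t : between a b t -> {for t, continuous (fun s => -1 * u s)}.
  by move=> /cu h; apply: continuousM; [exact: cst_continuous|exact: h].
have B (v : R -> R) : (forall t, between a b t -> {for t, continuous v}) ->
    (forall t, `|v t| <= normc (g t)) -> `|ointr a b v| <= ointr a b u.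
  move=> cv vg; rewrite ler_norml -mulN1r -ointrZ//; apply/andP; split.
    apply: ointr_ge => // t /gu tu; have := vg t; rewrite ler_norml mulN1r; lra.
  apply: ointr_ge => // t /gu tu; have := vg t; rewrite ler_norml; lra.
have := B _ (fun t th => (cg t th).1) (fun t => normr_Re_le _).
have := B _ (fun t th => (cg t th).2) (fun t => normr_Im_le _).
lra.
Qed.

Lemma cderiv_ext f g z l (r : R) : 0 < r ->
  (forall w, normc (w - z) < r -> f w = g w) -> cderiv f z l -> cderiv g z l.
Proof.
move=> r0 fg cf e /cf[d d0 H]; exists (Num.min d r); first by rewrite lt_min d0.
move=> h; rewrite lt_min => /andP[wd wr]; rewrite -!fg//; last 2 first.
- by rewrite subrr Normc.normc0.
- by rewrite addrC addKr.
exact: H.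
Qed.

Lemma ex_cderiv_subC f z (k : R[i]) :
  (exists l, cderiv f z l) -> exists l, cderiv (fun w => f w - k) z l.
Proof.
move=> [l fl]; exists l => e /fl[d d0 H]; exists d => // h /H.
by rewrite (_ : f (z + h) - k - (f z - k) = f (z + h) - f z)//; ring.
Qed.

Lemma ex_cderivM f g z : (exists l, cderiv f z l) -> (exists l, cderiv g z l) ->
  exists l, cderiv (fun w => f w * g w) z l.
Proof.
move=> [l fl] [m gm]; exists (l * g z + f z * m) => e e0.
pose A := normc (g z) + 1; pose B := normc l + 1; pose C := normc (f z) + 1.
have A0 : 0 < A by rewrite /A; have := normc_ge0 (g z); lra.
have B0 : 0 < B by rewrite /B; have := normc_ge0 l; lra.
have C0 : 0 < C by rewrite /C; have := normc_ge0 (f z); lra.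
have [eA eB eC] : [/\ 0 < e / 3 / A, 0 < e / 3 / B & 0 < e / 3 / C].
  by rewrite !divr_gt0.
have [d1 d10 H1] := fl _ eA.
have [d2 d20 H2] := cderiv_ccont gm eB.
have [d3 d30 H3] := cderiv_ccont gm ltr01.
have [d4 d40 H4] := gm _ eC.
exists (Num.min (Num.min d1 d2) (Num.min d3 d4)); first by rewrite !lt_min d10 d20 d30.
move=> h; rewrite !lt_min => /andP[/andP[h1 h2] /andP[h3 h4]].
have {}H1 := H1 _ h1; have {}H4 := H4 _ h4.
have {}H2 : normc (g (z + h) - g z) < e / 3 / B by apply: H2; rewrite addrC addKr.
have {}H3 : normc (g (z + h)) <= A.
  have : normc (g (z + h) - g z) < 1 by apply: H3; rewrite addrC addKr.
  by have := lenormcB (g (z + h)) (g z); rewrite /A; lra.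
rewrite [X in normc X](_ : _ = (f (z + h) - f z - l * h) * g (z + h) +
  (l * h * (g (z + h) - g z) + f z * (g (z + h) - g z - m * h))); last by ring.
have t1 := normc_triangle ((f (z + h) - f z - l * h) * g (z + h))
  (l * h * (g (z + h) - g z) + f z * (g (z + h) - g z - m * h)).
have t2 := normc_triangle (l * h * (g (z + h) - g z)) (f z * (g (z + h) - g z - m * h)).
rewrite !Normc.normcM in t1 t2.
have p1 := ler_pM (normc_ge0 _) (normc_ge0 _) H1 H3.
have lB : normc l <= B by rewrite /B; lra.
have p2 := ler_pM (mulr_ge0 (normc_ge0 l) (normc_ge0 h)) (normc_ge0 _)
  (ler_wpM2r (normc_ge0 h) lB) (ltW H2).
have fC : normc (f z) <= C by rewrite /C; lra.
have p3 := ler_pM (normc_ge0 _) (normc_ge0 _) fC H4.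
have E1 : e / 3 / A * normc h * A = e / 3 * normc h.
  by rewrite mulrAC divfK ?gt_eqF.
have E2 : B * normc h * (e / 3 / B) = e / 3 * normc h.
  by rewrite mulrC mulrA divfK ?gt_eqF.
have E3 : C * (e / 3 / C * normc h) = e / 3 * normc h.
  by rewrite mulrA (mulrC C) divfK ?gt_eqF.
rewrite E1 in p1; rewrite E2 in p2; rewrite E3 in p3; lra.
Qed.

Lemma ex_cderiv_inv z z0 : z != z0 ->
  exists l, cderiv (fun w : R[i] => (w - z0)^-1) z l.
Proof.
move=> zz0; pose a := z - z0; have a0 : a != 0 by rewrite subr_eq0.
have n0 : 0 < normc a by rewrite normc_gt0.
exists (- a ^- 2) => e e0.
exists (Num.min (normc a / 2) (e * normc a ^+ 3 / 2)).
  by rewrite lt_min !divr_gt0 ?mulr_gt0 ?exprn_gt0.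
move=> h; rewrite lt_min => /andP[h1 h2].
have ah : normc a / 2 <= normc (a + h).
  by have := lenormcB a (- h); rewrite normc_opp opprK; lra.
have ah0 : a + h != 0 by rewrite -normc_gt0; lra.
have -> : z + h - z0 = a + h by rewrite /a; ring.
have -> : (a + h)^-1 - (z - z0)^-1 - - a ^- 2 * h = h * h * (a * a * (a + h))^-1.
  by rewrite -/a; field; rewrite ?a0 ?ah0.
rewrite !Normc.normcM Normc.normcV !Normc.normcM.
rewrite mulrAC ler_wpM2r ?normc_ge0// ler_pdivrMr ?mulr_gt0//; last first.
  by rewrite normc_gt0.
rewrite (le_trans (ltW h2))//.
have -> : e * normc a ^+ 3 / 2 = e * (normc a * normc a * (normc a / 2)).
  by rewrite !exprS expr0; field.
by rewrite ler_wpM2l ?(ltW e0)// ler_wpM2l// mulr_ge0 ?normc_ge0.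
Qed.

Lemma ex_cderiv_quotient f z z0 : z != z0 -> (exists l, cderiv f z l) ->
  exists l, cderiv (fun w => (f w - f z0) / (w - z0)) z l.
Proof.
move=> zz0 df; apply: ex_cderivM; first exact: ex_cderiv_subC.
exact: ex_cderiv_inv.
Qed.

Definition diff_quotient f (z0 l z : R[i]) : R[i] :=
  if z == z0 then l else (f z - f z0) / (z - z0).

Lemma ccont_diff_quotient f z0 l : cderiv f z0 l ->
  ccont (diff_quotient f z0 l) z0.
Proof.
move=> fl e e0; have e2 : 0 < e / 2 by rewrite divr_gt0.
have [d d0 H] := fl _ e2; exists d => // w wd.
rewrite /diff_quotient eqxx; case: eqVneq => [_|wz].
  by rewrite subrr Normc.normc0.
have wz0 : w - z0 != 0 by rewrite subr_eq0.
have := H _ wd; rewrite (addrC z0) subrK => {}H.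
have -> : (f w - f z0) / (w - z0) - l = (f w - f z0 - l * (w - z0)) / (w - z0).
  by field.
rewrite Normc.normcM Normc.normcV ltr_pdivrMr ?normc_gt0//.
rewrite (le_lt_trans H)// ltr_pM2r ?normc_gt0//; lra.
Qed.

Lemma ex_cderiv_diff_quotient f z0 l z : z != z0 -> (exists l, cderiv f z l) ->
  exists l', cderiv (diff_quotient f z0 l) z l'.
Proof.
move=> zz0 /(ex_cderiv_quotient zz0)[l' H]; exists l'.
apply: cderiv_ext H; first by rewrite -(subr_eq0 z) -normc_gt0 in zz0; exact: zz0.
move=> w wz; rewrite /diff_quotient; case: eqVneq => // E.
by move: wz; rewrite E normcB ltxx.
Qed.

(** The true value is 2 pi i.  The imaginary part of the integrand, on each
    pair of opposite sides, is 2r / (u^2 + r^2) >= 1/r, which integrates to at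
    least 2 over a side of length 2r. *)
Lemma rect_inv_ge4 (x y r : R) : 0 < r ->
  4 <= normc (rect (fun z => (z - (x +i* y))^-1) (x - r) (x + r) (y - r) (y + r)).
Proof.
move=> r0; set k := fun z => _; apply: le_trans (normr_Im_le _).
apply: le_trans (ler_norm _).
have nz1 s t : t != y -> s +i* t - (x +i* y) != 0.
  by rewrite subr_eq0; apply: contra => /eqP[_ ->].
have nz2 s t : s != x -> s +i* t - (x +i* y) != 0.
  by rewrite subr_eq0; apply: contra => /eqP[-> _].
have ck z : z - (x +i* y) != 0 -> ccont k z.
  by rewrite subr_eq0 => /ex_cderiv_inv[l /cderiv_ccont].
have ymr : y - r != y by rewrite lt_eqF//; lra.
have ypr : y + r != y by rewrite gt_eqF//; lra.
have xmr : x - r != x by rewrite lt_eqF//; lra.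
have xpr : x + r != x by rewrite gt_eqF//; lra.
have sq0 u : 0 < u ^+ 2 + r ^+ 2.
  by rewrite ltr_wpDl ?sqr_ge0// exprn_gt0.
have lb u : - r <= u <= r -> r^-1 <= 2 * r / (u ^+ 2 + r ^+ 2).
  move=> ur; rewrite ler_pdivlMr// mulrC ler_pdivrMr//.
  have : 0 <= (r - u) * (r + u) by apply: mulr_ge0; lra.
  by rewrite !expr2; lra.
have Imh s : complex.Im (k (s +i* (y - r)) - k (s +i* (y + r))) =
    2 * r / ((s - x) ^+ 2 + r ^+ 2).
  rewrite /k /=; have := sq0 (s - x).
  rewrite (_ : y - r - y = - r); last by ring.
  rewrite (_ : y + r - y = r); last by ring.
  by move=> h; rewrite sqrrN; field; rewrite gt_eqF.
have Rev t : complex.Re (k ((x + r) +i* t) - k ((x - r) +i* t)) =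
    2 * r / ((t - y) ^+ 2 + r ^+ 2).
  rewrite /k /=; have := sq0 (t - y).
  rewrite (_ : x - r - x = - r); last by ring.
  rewrite (_ : x + r - x = r); last by ring.
  by move=> h; rewrite sqrrN [r ^+ 2 + _]addrC; field; rewrite gt_eqF.
have c1 t : pcont (fun s => k (s +i* (y - r)) - k (s +i* (y + r))) t.
  by apply: pcontB; apply: pcont_hor; apply: ck; exact: nz1.
have c2 t : pcont (fun t => k ((x + r) +i* t) - k ((x - r) +i* t)) t.
  by apply: pcontB; apply: pcont_ver; apply: ck; exact: nz2.
have cr t : {for t, continuous (fun=> r^-1 : R)} by exact: cst_continuous.
have I1 : 2 <= ointr (x - r) (x + r)
    (fun s => complex.Im (k (s +i* (y - r)) - k (s +i* (y + r)))).
  apply: le_trans (_ : ointr (x - r) (x + r) (fun=> r^-1) <= _).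
    by rewrite ointr_cst (_ : x + r - (x - r) = 2 * r); [rewrite mulfK ?gt_eqF|ring].
  apply: ointr_ge => [|t _|t _|t ht]; [lra|exact: cr|exact: (c1 t).2|].
  by rewrite Imh lb//; lra.
have I2 : 2 <= ointr (y - r) (y + r)
    (fun t => complex.Re (k ((x + r) +i* t) - k ((x - r) +i* t))).
  apply: le_trans (_ : ointr (y - r) (y + r) (fun=> r^-1) <= _).
    by rewrite ointr_cst (_ : y + r - (y - r) = 2 * r); [rewrite mulfK ?gt_eqF|ring].
  apply: ointr_ge => [|t _|t _|t ht]; [lra|exact: cr|exact: (c2 t).1|].
  by rewrite Rev lb//; lra.
rewrite /rect raddfD/= mul0r mul1r add0r; lra.
Qed.

(** The difference quotient of f at the centre integrates to 0 around the
    square, so f(z) / (z - z0) integrates to f(z0) times the integral of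
    1 / (z - z0); on the boundary |z - z0| >= r. *)
Lemma cauchy_square f (x y r : R) : differentiable_uhp f -> 0 < r -> r < y ->
  2 * r * normc (f (x +i* y)) <=
  ointr (x - r) (x + r) (fun s => normc (f (s +i* (y - r))) + normc (f (s +i* (y + r))))
  + ointr (y - r) (y + r) (fun t => normc (f ((x + r) +i* t)) + normc (f ((x - r) +i* t))).
Proof.
move=> df r0 ry; set z0 := x +i* y.
have y0 : 0 < y by lra.
have [l fl] := df x y y0.
pose q := diff_quotient f z0 l.
pose k z := (z - z0)^-1.
pose g z := f z * k z.
have dq s t : 0 < t -> s +i* t != z0 -> exists l', cderiv q (s +i* t) l'.
  by move=> t0 st; apply: ex_cderiv_diff_quotient => //; exact: df.
have q0 : rect q (x - r) (x + r) (y - r) (y + r) = 0.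
  apply: (@goursat_point _ _ _ x _ _ y); [lra|lra| |].
    move=> s t; rewrite !betweenP; [|lra..] => hs ht.
    have [->|st] := eqVneq (s +i* t) z0; first exact: ccont_diff_quotient.
    have t0 : 0 < t by lra.
    by have [l' /cderiv_ccont] := dq s t t0 st.
  by move=> s t hs ht; apply: dq; lra.
have nz1 s t : t != y -> s +i* t != z0.
  by apply: contra => /eqP[_ ->].
have nz2 s t : s != x -> s +i* t != z0.
  by apply: contra => /eqP[-> _].
have dk s t : s +i* t != z0 -> exists l, cderiv k (s +i* t) l by exact: ex_cderiv_inv.
have dg s t : 0 < t -> s +i* t != z0 -> exists l, cderiv g (s +i* t) l.
  by move=> t0 st; apply: ex_cderivM; [exact: df|exact: dk].
have ymr : y - r != y by rewrite lt_eqF//; lra.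
have ypr : y + r != y by rewrite gt_eqF//; lra.
have xmr : x - r != x by rewrite lt_eqF//; lra.
have xpr : x + r != x by rewrite gt_eqF//; lra.
have tpos t : between (y - r) (y + r) t -> 0 < t.
  by rewrite betweenP; lra.
have sides (h : R[i] -> R[i]) :
    (forall s t, 0 < t -> s +i* t != z0 -> exists l, cderiv h (s +i* t) l) ->
    ccont_sides h (x - r) (x + r) (y - r) (y + r).
  move=> dh; have ch s t : 0 < t -> s +i* t != z0 -> ccont h (s +i* t).
    by move=> t0 st; have [l' /cderiv_ccont] := dh s t t0 st.
  split=> t ht; apply: ch => //; [lra|exact: nz1|lra|exact: nz1| | | |];
    by [exact: tpos|exact: nz2].
have sk : ccont_sides k (x - r) (x + r) (y - r) (y + r).
  by apply: sides => s t _; exact: dk.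
have E : rect q (x - r) (x + r) (y - r) (y + r) =
   rect g (x - r) (x + r) (y - r) (y + r) - f z0 * rect k (x - r) (x + r) (y - r) (y + r).
  rewrite -rect_linear//; last exact: sides.
  have qE z : z != z0 -> q z = g z - f z0 * k z.
    by move=> zz; rewrite /q /diff_quotient (negbTE zz) /g /k mulrBl.
  rewrite /rect; congr (_ + 'i%C * _); apply: eq_oint => t _;
    by rewrite !qE//; solve [exact: nz1 | exact: nz2].
have {E q0} E : rect g (x - r) (x + r) (y - r) (y + r) =
    f z0 * rect k (x - r) (x + r) (y - r) (y + r).
  by apply/eqP; rewrite -subr_eq0 -E q0.
have K4 : 4 * normc (f z0) <= normc (rect g (x - r) (x + r) (y - r) (y + r)).
  by rewrite E Normc.normcM mulrC ler_wpM2l ?normc_ge0// rect_inv_ge4.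
have kb1 s t : r <= `|t - y| -> normc (k (s +i* t)) <= r^-1.
  move=> h; rewrite /k Normc.normcV lef_pV2 ?posrE//.
    by rewrite (le_trans h)// (le_trans _ (normr_Im_le _)).
  by rewrite (lt_le_trans r0)// (le_trans h)// (le_trans _ (normr_Im_le _)).
have kb2 s t : r <= `|s - x| -> normc (k (s +i* t)) <= r^-1.
  move=> h; rewrite /k Normc.normcV lef_pV2 ?posrE//.
    by rewrite (le_trans h)// (le_trans _ (normr_Re_le _)).
  by rewrite (lt_le_trans r0)// (le_trans h)// (le_trans _ (normr_Re_le _)).
have gB z w : normc (k z) <= r^-1 -> normc (k w) <= r^-1 ->
    normc (g z - g w) <= r^-1 * (normc (f z) + normc (f w)).
  move=> kz kw; rewrite (le_trans (normc_triangle _ _))// normc_opp mulrDr.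
  by rewrite lerD// /g Normc.normcM mulrC ler_wpM2r// normc_ge0.
have cf s t : 0 < t -> ccont f (s +i* t).
  by move=> t0; have [l' /cderiv_ccont] := df s t t0.
have sg := sides g dg; case: sg => g1 g2 g3 g4.
have ym0 : 0 < y - r by lra.
have yp0 : 0 < y + r by lra.
have cu t : {for t, continuous (fun s => normc (f (s +i* (y - r))) + normc (f (s +i* (y + r))))}.
  by apply: continuousD; apply: normc_continuous; apply: pcont_hor; exact: cf.
have cv t : 0 < t -> {for t, continuous (fun t => normc (f ((x + r) +i* t)) + normc (f ((x - r) +i* t)))}.
  by move=> t0; apply: continuousD; apply: normc_continuous; apply: pcont_ver; exact: cf.
have crZ (u : R -> R) t : {for t, continuous u} -> {for t, continuous (fun s => r^-1 * u s)}.
  by move=> hu; apply: continuousM; [exact: cst_continuous|exact: hu].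
have nr1 : r <= `|y - r - y| by rewrite addrC addKr normrN ler_norm.
have nr2 : r <= `|y + r - y| by rewrite addrC addKr ler_norm.
have nr3 : r <= `|x - r - x| by rewrite addrC addKr normrN ler_norm.
have nr4 : r <= `|x + r - x| by rewrite addrC addKr ler_norm.
have h1 : normc (oint (x - r) (x + r) (fun s => g (s +i* (y - r)) - g (s +i* (y + r)))) <=
    2 * (r^-1 * ointr (x - r) (x + r) (fun s => normc (f (s +i* (y - r))) + normc (f (s +i* (y + r))))).
  rewrite -ointrZ//; apply: oint_norm; first by lra.
  - by move=> t ht; apply: pcontB; apply: pcont_hor; [exact: g1|exact: g2].
  - by move=> t _; exact: crZ.
  - by move=> t _; apply: gB; apply: kb1.
have h2 : normc (oint (y - r) (y + r) (fun t => g ((x + r) +i* t) - g ((x - r) +i* t))) <=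
    2 * (r^-1 * ointr (y - r) (y + r) (fun t => normc (f ((x + r) +i* t)) + normc (f ((x - r) +i* t)))).
  rewrite -ointrZ; last by move=> t /tpos; exact: cv.
  apply: oint_norm; first by lra.
  - by move=> t ht; apply: pcontB; apply: pcont_ver; [exact: g4|exact: g3].
  - by move=> t /tpos t0; apply: crZ; exact: cv.
  - by move=> t _; apply: gB; apply: kb2.
set I1 := ointr _ _ _ in h1 *; set I2 := ointr _ _ _ in h2 *.
have := normc_triangle (oint (x - r) (x + r) (fun s => g (s +i* (y - r)) - g (s +i* (y + r))))
  ('i%C * oint (y - r) (y + r) (fun t => g ((x + r) +i* t) - g ((x - r) +i* t))).
rewrite -/(rect g (x - r) (x + r) (y - r) (y + r)) Normc.normcM normc_i mul1r => T.
have {T h1 h2 K4} : 4 * normc (f z0) <= 2 * (r^-1 * I1) + 2 * (r^-1 * I2).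
  by apply: (le_trans K4); apply: (le_trans T); exact: lerD.
have rr : r * r^-1 = 1 by rewrite divff ?gt_eqF.
move=> /(ler_wpM2l (ltW r0)).
have -> : r * (2 * (r^-1 * I1) + 2 * (r^-1 * I2)) = 2 * (r * r^-1) * (I1 + I2) by ring.
rewrite rr; lra.
Qed.

End cauchy_square.

(** * Affine substitution and joint measurability *)

Section measure_tools.
Variable R : realType.
Notation mu := (@lebesgue_measure R).

Lemma measurable_affine (k c : R) : measurable_fun [set: measurableTypeR R]
  ((fun x => k * x + c) : measurableTypeR R -> measurableTypeR R).
Proof. by apply: measurable_funD => //; exact: measurable_funM. Qed.

(** The measure structure of a push-forward is indexed by the measurability of
    the map, which is supplied here. *)
Definition affine_image (k c : R) : {measure set (measurableTypeR R) -> \bar R}.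
Proof.
pose m : {measure set (measurableTypeR R) -> \bar R} :=
  pushforward mu ((fun x => k * x + c) : measurableTypeR R -> measurableTypeR R).
exact: (m (measurable_affine k c)).
Defined.

Lemma lebesgue_measure_affine (k c : R) (A : set R) : k != 0 -> measurable A ->
  mu A = (`|k|%:E * mu ((fun x => (k * x + c)%R) @^-1` A))%E.
Proof.
move=> k0 mA.
pose m := affine_image k c.
pose nu : {measure set (measurableTypeR R) -> \bar R} :=
  mscale (NngNum (normr_ge0 k)) m.
rewrite -[RHS]/(nu A); apply: lebesgue_measure_unique => // _ [[a b] _ <-].
rewrite /nu/= /mscale/= /m /pushforward/=.
have [k_gt0|k_lt0|/eqP] := ltgtP 0 k; last by rewrite eq_sym (negbTE k0).
- rewrite (_ : _ @^-1` _ = `](a - c) / k, (b - c) / k]%classic); last first.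
    apply/seteqP; split=> x /=; rewrite !in_itv/= ltr_pdivrMr// ler_pdivlMr//;
      by rewrite mulrC ltrBlDr lerBrDr.
  rewrite !lebesgue_measure_itv/= !lte_fin ltr_pM2r ?invr_gt0// ltrD2r.
  case: ifPn => _; last by rewrite mule0.
  by rewrite gtr0_norm// -!EFinD -EFinM; congr EFin; field.
- rewrite (_ : _ @^-1` _ = `[(b - c) / k, (a - c) / k[%classic); last first.
    apply/seteqP; split=> x /=; rewrite !in_itv/= ltr_ndivlMr// ler_ndivrMr//;
      by rewrite mulrC ltrBlDr lerBrDr andbC.
  rewrite !lebesgue_measure_itv/= !lte_fin ltr_nM2r ?invr_lt0// ltrD2r.
  case: ifPn => _; last by rewrite mule0.
  by rewrite ltr0_norm// -!EFinD -EFinM; congr EFin; field; rewrite lt_eqF.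
Qed.

Lemma ge0_integral_affine (k c : R) (f : R -> \bar R) : k != 0 ->
  measurable_fun setT f -> (forall x, 0 <= f x)%E ->
  (\int[mu]_x f x = `|k|%:E * \int[mu]_x f (k * x + c)%R)%E.
Proof.
move=> k0 mf f0.
pose m := affine_image k c.
pose nu : {measure set (measurableTypeR R) -> \bar R} :=
  mscale (NngNum (normr_ge0 k)) m.
rewrite (@eq_measure_integral _ _ _ _ nu); last first.
  by move=> A mA _; exact: (lebesgue_measure_affine c k0 mA).
rewrite /nu ge0_integral_mscale//; congr (_ * _)%E.
by rewrite /m (ge0_integral_pushforward (measurable_affine k c)).
Qed.

(** An open set is a union of boxes with rational centres and radii 1/(n+1). *)
Lemma open_measurable_prod (A : set (R * R)) : open A -> measurable A.
Proof.
move=> oA.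
pose B (q : rat * rat * nat) : set (R * R) :=
  ball (ratr q.1.1 : R) (q.2.+1%:R^-1) `*` ball (ratr q.1.2 : R) (q.2.+1%:R^-1).
pose P q := B q `<=` A.
rewrite (_ : A = \bigcup_(q in P) B q); last first.
  apply/seteqP; split => [[x y] Axy|x [q Pq Bq]]; last exact: Pq.
  have : nbhs (x, y) A by exact: open_nbhs_nbhs.
  move=> /nbhs_ballP[e /= e0 eA].
  have e2 : 0 < e / 2 by rewrite divr_gt0.
  have [n ne] : exists n, (n.+1%:R^-1 : R) < e / 2.
    have := near_infty_natSinv_lt (PosNum e2); move=> [n _ /(_ n (leqnn n))]/= H.
    by exists n.
  have [i iE] : exists i, i = (n.+1%:R^-1 : R) by exists n.+1%:R^-1.
  have i0 : 0 < i by rewrite iE invr_gt0.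
  rewrite -iE in ne.
  have xx : x - i < x + i by lra.
  have yy : y - i < y + i by lra.
  have [p] := rat_in_itvoo xx; have [q] := rat_in_itvoo yy.
  rewrite !in_itv/= => qy px.
  exists (p, q, n); rewrite /P /B /= -iE.
    move=> [u v] [/= hu hv]; apply: eA; split; rewrite /ball/=.
      move: hu; rewrite /ball/= !ltr_norml; lra.
    move: hv; rewrite /ball/= !ltr_norml; lra.
  by split => /=; rewrite /ball/= ltr_norml; lra.
rewrite bigcup_mkcond; apply: countable_bigcupT_measurable.
  exact: countableP.
move=> q; case: ifP => // _; apply: measurableX; exact: measurable_ball.
Qed.

End measure_tools.

Section absolute_value.
Variable R : realType.
Notation mu := (@lebesgue_measure R).
Notation normc := (@Normc.normc R).

(** Extending |f| by 0 below the real axis gives a lower semicontinuous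
    function on the whole plane, hence a Borel function that may be composed
    with any measurable maps. *)
Definition uhp_norm (f : R[i] -> R[i]) (u : R * R) : R :=
  if 0 < u.2 then normc (f (u.1 +i* u.2)) else 0.

Lemma uhp_norm_ge0 f u : 0 <= uhp_norm f u.
Proof. by rewrite /uhp_norm; case: ifP => // _; exact: normc_ge0. Qed.

Lemma uhp_normE f (x y : R) : 0 < y -> uhp_norm f (x, y) = normc (f (x +i* y)).
Proof. by rewrite /uhp_norm/= => ->. Qed.

Lemma measurable_uhp_norm f : differentiable_uhp f ->
  measurable_fun [set: R * R] (uhp_norm f).
Proof.
move=> df; apply: (measurability _ (RGenOInfty.measurableE R)).
move=> /= _ [_ [a ->] <-]; rewrite setTI.
have [a0|a0] := ltP a 0.
  rewrite (_ : _ @^-1` _ = setT); first exact: measurableT.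
  apply/seteqP; split => // u _ /=; rewrite in_itv/= andbT.
  by rewrite (lt_le_trans a0)// uhp_norm_ge0.
apply: open_measurable_prod; rewrite openE => -[x y] /=; rewrite in_itv/= andbT.
rewrite /uhp_norm/=; case: ifPn => [y0|_]; last by rewrite ltNge a0.
move=> af; have d0 : 0 < normc (f (x +i* y)) - a by lra.
have [d d1 H] := ccont_differentiable_uhp df x y0 d0.
apply/nbhs_ballP; exists (Num.min y (d / 2)) => /=.
  by rewrite lt_min y0 divr_gt0.
move=> [s t] []; rewrite /ball/= !lt_min => /andP[_ sx] /andP[ty ty'].
rewrite in_itv/= andbT; have t0 : 0 < t by move: ty; rewrite ltr_norml; lra.
rewrite t0; have := H (s +i* t).
rewrite (le_lt_trans (normc_le_ReIm _))//=; last first.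
  by rewrite distrC (distrC t); lra.
move=> /(_ isT); rewrite normcB; have := lenormcB (f (x +i* y)) (f (s +i* t)); lra.
Qed.

End absolute_value.

(** * Growth of functions with bounded horizontal means *)

Section tonelli_on.
Variable R : realType.
Notation mu := (@lebesgue_measure R).
Variables (D E : set R) (mD : measurable D) (mE : measurable E).
Variable g : R * R -> \bar R.
Hypothesis mg : measurable_fun [set: R * R] g.
Hypothesis g0 : forall u, (0 <= g u)%E.

Let h := g \_ (D `*` E).

Let mh : measurable_fun setT h.
Proof.
apply/(measurable_restrictT _ _).1; first exact: measurableX.
exact: measurable_funS mg.
Qed.

Let h0 u : (0 <= h u)%E.
Proof. by rewrite /h patchE; case: ifP. Qed.

Let hF x : (\int[mu]_y h (x, y) = ((fun x => \int[mu]_(y in E) g (x, y)) \_ D) x)%E.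
Proof.
rewrite [in RHS]patchE; case: ifPn => xD.
  rewrite [RHS]integral_mkcond; apply: eq_integral => y _.
  rewrite /h !patchE; congr (if _ then _ else _).
  apply/idP/idP => [|yE]; first by rewrite inE => -[_ yE]; rewrite inE.
  by rewrite inE; split => /=; [move: xD; rewrite inE|move: yE; rewrite inE].
apply: integral0_eq => y _; rewrite /h patchE; case: ifPn => // /set_mem[/= Dx _].
by rewrite (mem_set Dx) in xD.
Qed.

Let hG y : (\int[mu]_x h (x, y) = ((fun y => \int[mu]_(x in D) g (x, y)) \_ E) y)%E.
Proof.
rewrite [in RHS]patchE; case: ifPn => yE.
  rewrite [RHS]integral_mkcond; apply: eq_integral => x _.
  rewrite /h !patchE; congr (if _ then _ else _).
  apply/idP/idP => [|xD]; first by rewrite inE => -[xD _]; rewrite inE.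
  by rewrite inE; split => /=; [move: xD; rewrite inE|move: yE; rewrite inE].
apply: integral0_eq => x _; rewrite /h patchE; case: ifPn => // /set_mem[/= _ Ey].
by rewrite (mem_set Ey) in yE.
Qed.

(** Restricted to D and E, the iterated integrals of g are those over the whole
    line of g extended by 0 outside D x E. *)
Lemma tonelli_on : (\int[mu]_(x in D) \int[mu]_(y in E) g (x, y) =
  \int[mu]_(y in E) \int[mu]_(x in D) g (x, y))%E.
Proof.
rewrite integral_mkcond [RHS]integral_mkcond.
transitivity (\int[mu]_x \int[mu]_y h (x, y))%E.
  by apply: eq_integral => x _; rewrite hF.
transitivity (\int[mu]_y \int[mu]_x h (x, y))%E; last first.
  by apply: eq_integral => x _; rewrite hG.
exact: (fubini_tonelli (m1 := mu) (m2 := mu) h mh h0).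
Qed.

Lemma measurable_integral_on :
  measurable_fun D (fun x => \int[mu]_(y in E) g (x, y))%E.
Proof.
apply/(measurable_restrictT (fun x => \int[mu]_(y in E) g (x, y))%E mD).
apply: (eq_measurable_fun (fubini_F mu h)).
  by move=> x _; rewrite /fubini_F hF.
exact: (measurable_fun_fubini_tonelli_F (m2 := mu) h mh h0).
Qed.

End tonelli_on.

Section growth.
Variable R : realType.
Notation mu := (@lebesgue_measure R).
Notation normc := (@Normc.normc R).

(** If v > A then v <= v (v/A)^(r-1).  Integrated with a suitable A, this
    serves as Hoelder's inequality against a weight. *)
Lemma powR_split (A v r : R) : 0 < A -> 0 <= v -> 1 <= r ->
  v <= A + A / A `^ r * v `^ r.
Proof.
move=> A0 v0 r1.
have p0 : 0 <= A / A `^ r * v `^ r.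
  by rewrite mulr_ge0// ?powR_ge0// divr_ge0 ?powR_ge0// ltW.
have [vA|/ltW Av] := leP v A; first lra.
have Ap : 0 < A `^ r by rewrite powR_gt0.
have : v / A * A `^ r <= (v / A * A) `^ r.
  by apply: le1r_powRZ => //; [rewrite ler_pdivlMr// mul1r|exact: ltW].
rewrite divfK ?gt_eqF// => H.
suff : v <= A / A `^ r * v `^ r by lra.
rewrite mulrAC ler_pdivlMr//.
have -> : v * A `^ r = A * (v / A * A `^ r) by field; rewrite gt_eqF.
by rewrite ler_wpM2l// ltW.
Qed.

Lemma EFin_ointr (a b : R) (u : R -> R) : a <= b ->
  (forall t, between a b t -> {for t, continuous u}) ->
  (ointr a b u)%:E = (\int[mu]_(s in `[a, b]) (u s)%:E)%E.
Proof.
move=> ab cu; rewrite ointr_le// /Rintegral fineK//.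
apply: integrable_fin_num => //; apply: continuous_integrable_itv => t tab.
by apply: cu; rewrite betweenP.
Qed.

Variable f : R[i] -> R[i].
Hypothesis df : differentiable_uhp f.
Notation N := (uhp_norm f).

Lemma measurable_uhp_norm_comp d (T : measurableType d) (phi psi : T -> R) :
  measurable_fun setT phi -> measurable_fun setT psi ->
  measurable_fun setT (fun t => N (phi t, psi t)).
Proof.
move=> mphi mpsi; apply: (measurableT_comp (measurable_uhp_norm df)).
exact: measurable_fun_pair.
Qed.

Lemma measurable_uhp_norm_affine (k c v : R) :
  measurable_fun [set: R] (fun s : R => N (k * s + c, v)).
Proof.
have mphi : measurable_fun [set: R] (fun s : R => k * s + c) by exact: measurable_affine.
by apply: measurable_uhp_norm_comp => //; exact: measurable_cst.
Qed.

Variables (r S : R).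
Hypothesis r1 : 1 < r.
Hypothesis S0 : 0 <= S.
Hypothesis NS : forall y, 0 < y -> (\int[mu]_x ((N (x, y)) `^ r)%:E <= S%:E)%E.

(** The slopes k = 1 and k = -1 are the cases in use: the left side of the
    square of half-width t centred at x has abscissa x - t. *)
Lemma integral_uhp_norm_le (D : set R) (m A k c y : R) : measurable D ->
  (mu D <= m%:E)%E -> 0 <= m -> 0 < A -> 0 < y -> `|k| = 1 ->
  (\int[mu]_(s in D) (N ((k * s + c)%R, y))%:E <= (A * m + A / A `^ r * S)%:E)%E.
Proof.
move=> mD Dm m0 A0 y0 k1.
have k0 : k != 0 by rewrite -normr_eq0 k1 oner_eq0.
set C := A / A `^ r; have C0 : 0 <= C by rewrite divr_ge0 ?powR_ge0// ltW.
have mN := measurable_uhp_norm_affine k c y.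
have mNr : measurable_fun [set: R] (fun s : R => N (k * s + c, y) `^ r).
  exact: (measurableT_comp (measurable_powR r) mN).
have mNr1 : measurable_fun [set: R] (fun s : R => N (s, y) `^ r).
  apply: (measurableT_comp (measurable_powR r)).
  by apply: measurable_uhp_norm_comp => //; exact: measurable_cst.
apply: (@le_trans _ _ (\int[mu]_(s in D) (A%:E + C%:E * (N ((k * s + c)%R, y) `^ r)%:E))%E).
  apply: ge0_le_integral => //.
  - by move=> s _; rewrite lee_fin uhp_norm_ge0.
  - by apply/measurable_EFinP; exact: measurable_funTS.
  - apply: emeasurable_funD => //; apply: emeasurable_funM => //.
    by apply/measurable_EFinP; exact: measurable_funTS.
  - move=> s _; rewrite -EFinM -EFinD lee_fin.
    by apply: powR_split => //; [exact: uhp_norm_ge0|exact: ltW].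
rewrite ge0_integralD//; last 3 first.
- by move=> s _; rewrite lee_fin ltW.
- by move=> s _; rewrite mule_ge0// lee_fin ?powR_ge0.
- apply: emeasurable_funM => //.
  by apply/measurable_EFinP; exact: measurable_funTS.
rewrite EFinD; apply: leeD.
  by rewrite integral_cst// EFinM lee_wpmul2l// lee_fin ltW.
rewrite ge0_integralZl_EFin//; last 2 first.
- by move=> s _; rewrite lee_fin powR_ge0.
- by apply/measurable_EFinP; exact: measurable_funTS.
rewrite [leRHS]EFinM lee_wpmul2l//; apply: (le_trans _ (NS y0)).
rewrite [leRHS](@ge0_integral_affine _ k c)//; last 2 first.
- exact/measurable_EFinP.
- by move=> s; rewrite lee_fin powR_ge0.
rewrite k1 mul1e; apply: ge0_subset_integral => //.
- exact/measurable_EFinP.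
- by move=> s _; rewrite lee_fin powR_ge0.
Qed.

(** Cauchy's estimate is averaged over the squares of half-width t in
    [y/4, y/2], which stay above height y/2.  The horizontal sides are
    controlled for each t.  The vertical sides are controlled on average: as t
    varies, their points at a fixed height sweep horizontal intervals. *)
Lemma growth_bound (x y : R) : 0 < y ->
  normc (f (x +i* y)) <= (20 + 5 * S) * (y / 4) `^ (- r^-1).
Proof.
move=> y0; set d := y / 4; have d0 : 0 < d by rewrite divr_gt0.
have yd : y = 4 * d by rewrite /d; field.
set A := d `^ (- r^-1); have A0 : 0 < A by rewrite powR_gt0.
have r0 : 0 < r by exact: lt_trans ltr01 r1.
set C := A / A `^ r.
(* A was chosen so that the two terms of T / d are multiples of A. *)
have CA : C = A * d.
  rewrite /C /A -powRrM mulNr mulVf ?gt_eqF// powR_inv1 ?(ltW d0)// invrK//.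
pose T := 4 * d * A + C * S.
have C0 : 0 <= C by rewrite CA mulr_ge0// ltW.
have dA0 : 0 <= d * A by rewrite mulr_ge0// ltW.
have T0 : 0 <= T by rewrite /T -mulrA addr_ge0// mulr_ge0.
pose D : set R := `[d, 2 * d]%classic; pose E : set R := `[2 * d, 6 * d]%classic.
have muD : (mu D = d%:E)%E.
  rewrite /D lebesgue_measure_itv/= lte_fin ifT; last by lra.
  by rewrite -EFinD; congr EFin; ring.
have muE : (mu E = (4 * d)%:E)%E.
  rewrite /E lebesgue_measure_itv/= lte_fin ifT; last by lra.
  by rewrite -EFinD; congr EFin; ring.
have mD : measurable D by exact: measurable_itv.
have mE : measurable E by exact: measurable_itv.
have IcD (c : R) : (\int[mu]_(t in D) c%:E = (c * d)%:E)%E.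
  by rewrite integral_cst// EFinM; congr (_ * _)%E; exact: muD.
have IcE (c : R) : (\int[mu]_(t in E) c%:E = (c * (4 * d))%:E)%E.
  by rewrite integral_cst// EFinM; congr (_ * _)%E; exact: muE.
pose g (u : R * R) : \bar R := ((N ((1 * u.1 + x)%R, u.2))%:E + (N ((-1 * u.1 + x)%R, u.2))%:E)%E.
have g0 u : (0 <= g u)%E by rewrite adde_ge0// lee_fin uhp_norm_ge0.
have maff k : measurable_fun [set: R * R] (fun u : R * R => (k * u.1 + x)%R).
  exact: (measurableT_comp (measurable_affine k x) measurable_fst).
have mg : measurable_fun [set: R * R] g.
  by apply: emeasurable_funD; apply/measurable_EFinP; apply: measurable_uhp_norm_comp.
have key t : t \in D ->
    ((2 * d * normc (f (x +i* y)))%:E <= (2 * T)%:E + \int[mu]_(v in E) g (t, v))%E.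
  rewrite inE /D/= in_itv/= => /andP[dt td].
  have t0 : 0 < t by lra.
  have ty : t < y by lra.
  have cf s v : 0 < v -> ccont f (s +i* v) by exact: ccont_differentiable_uhp.
  have le1 : 2 * d * normc (f (x +i* y)) <= 2 * t * normc (f (x +i* y)).
    by rewrite ler_wpM2r ?normc_ge0//; lra.
  have := le_trans le1 (cauchy_square x df t0 ty); rewrite -lee_fin => /le_trans; apply.
  have c1 (s : R) : {for s, continuous (fun s => normc (f (s +i* (y - t))) +
      normc (f (s +i* (y + t))))}.
    by apply: continuousD; apply: normc_continuous; apply: pcont_hor; apply: cf; lra.
  have c2 v : between (y - t) (y + t) v -> {for v, continuous (fun v =>
      normc (f ((x + t) +i* v)) + normc (f ((x - t) +i* v)))}.
    move=> hv; have v0 : 0 < v by apply: between_gt0 hv; lra.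
    by apply: continuousD; apply: normc_continuous; apply: pcont_ver; apply: cf.
  rewrite EFinD; apply: leeD.
    rewrite EFin_ointr//; last by lra.
    rewrite [leLHS](_ : _ = \int[mu]_(s in `[(x - t)%R, (x + t)%R])
        ((N ((1 * s + 0)%R, (y - t)%R))%:E + (N ((1 * s + 0)%R, (y + t)%R))%:E))%E;
        last first.
      apply: eq_integral => s _; rewrite EFinD mul1r addr0.
      by rewrite -!uhp_normE//; lra.
    have mI : (mu `[(x - t)%R, (x + t)%R] <= (4 * d)%:E)%E.
      rewrite lebesgue_measure_itv/= lte_fin ifT; last by lra.
      by rewrite -EFinD lee_fin; lra.
    have bd v : 0 < v -> (\int[mu]_(s in `[(x - t)%R, (x + t)%R])
        (N ((1 * s + 0)%R, v))%:E <= T%:E)%E.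
      move=> v0; have -> : T = A * (4 * d) + C * S by rewrite /T mulrC.
      by apply: integral_uhp_norm_le => //; [lra|rewrite normr1].
    have mNI v : measurable_fun `[(x - t)%R, (x + t)%R] (fun s : R => (N ((1 * s + 0)%R, v))%:E).
      apply: measurable_funTS; apply/measurable_EFinP.
      exact: measurable_uhp_norm_affine.
    rewrite ge0_integralD//; last 4 first.
    - by move=> s _; rewrite lee_fin uhp_norm_ge0.
    - exact: mNI.
    - by move=> s _; rewrite lee_fin uhp_norm_ge0.
    - exact: mNI.
    have -> : 2 * T = T + T by ring.
    by rewrite EFinD leeD// bd//; lra.
  rewrite (EFin_ointr _ c2); last by lra.
  have sub : `[(y - t)%R, (y + t)%R] `<=` E.
    by move=> v; rewrite /E/= !in_itv/=; lra.
  apply: (@le_trans _ _ (\int[mu]_(v in `[(y - t)%R, (y + t)%R]) g (t, v))%E).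
    rewrite le_eqVlt; apply/orP; left; apply/eqP; apply: eq_integral => v.
    rewrite inE/= in_itv/= => hv; rewrite /g/= EFinD.
    by rewrite -!uhp_normE; [rewrite mul1r mulN1r (addrC t) (addrC (- t))|lra|lra].
  apply: ge0_subset_integral => //; apply: measurable_funTS.
  exact: (measurableT_comp mg (pair1_measurable _)).
have int1 : ((2 * d * normc (f (x +i* y)) * d)%:E <=
    \int[mu]_(t in D) ((2 * T)%:E + \int[mu]_(v in E) g (t, v)))%E.
  rewrite -IcD; apply: ge0_le_integral => //.
  - by move=> t _; rewrite lee_fin !mulr_ge0 ?normc_ge0// ltW.
  - by apply: emeasurable_funD => //; exact: measurable_integral_on.
  - by move=> t Dt; apply: key; rewrite inE.
have int2 : (\int[mu]_(t in D) ((2 * T)%:E + \int[mu]_(v in E) g (t, v)) <=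
    (10 * T * d)%:E)%E.
  rewrite ge0_integralD//; last 3 first.
  - by move=> t _; rewrite lee_fin mulr_ge0.
  - by move=> t _; exact: integral_ge0.
  - exact: measurable_integral_on.
  rewrite IcD tonelli_on//.
  have in3 v : v \in E -> (\int[mu]_(t in D) g (t, v) <= (2 * T)%:E)%E.
    rewrite inE /E/= in_itv/= => hv; have v0 : 0 < v by lra.
    have bd k : `|k| = 1 -> (\int[mu]_(t in D) (N ((k * t + x)%R, v))%:E <= T%:E)%E.
      move=> k1; have -> : T = A * (4 * d) + C * S by rewrite /T mulrC.
      apply: integral_uhp_norm_le => //; last by lra.
      by rewrite muD lee_fin; lra.
    have mND k : measurable_fun D (fun t : R => (N ((k * t + x)%R, v))%:E).
      apply: measurable_funTS; apply/measurable_EFinP.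
      exact: measurable_uhp_norm_affine.
    rewrite /g/= ge0_integralD//; last 4 first.
    - by move=> s _; rewrite lee_fin uhp_norm_ge0.
    - exact: mND.
    - by move=> s _; rewrite lee_fin uhp_norm_ge0.
    - exact: mND.
    have -> : 2 * T = T + T by ring.
    by rewrite EFinD leeD// bd// ?normrN normr1.
  apply: (@le_trans _ _ ((2 * T * d)%:E + \int[mu]_(v in E) (2 * T)%:E)%E).
    apply: leeD => //; apply: ge0_le_integral => //.
    - by move=> v _; exact: integral_ge0.
    - have mg' : measurable_fun [set: R * R] (fun u : R * R => g (u.2, u.1)).
        exact: (measurableT_comp mg (measurable_fun_pair measurable_snd measurable_fst)).
      exact: (@measurable_integral_on _ E D mE mD (fun u => g (u.2, u.1)) mg' (fun u => g0 _)).
    - by move=> v Ev; apply: in3; rewrite inE.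
  by rewrite IcE -EFinD lee_fin; lra.
have := le_trans int1 int2; rewrite lee_fin ler_pM2r//.
have -> : 10 * T = 2 * d * ((20 + 5 * S) * A) by rewrite /T CA; ring.
by rewrite ler_pM2l// mulr_gt0.
Qed.

End growth.

(** * Integrals along rays from the origin *)

Section real_integrals.
Variable R : realType.
Notation mu := (@lebesgue_measure R).

Lemma FTC2_pos (G g : R -> R) (a b : R) : 0 < a -> a <= b ->
  (forall s : R, 0 < s -> is_derive s 1 G (g s)) ->
  (forall s : R, 0 < s -> {for s, continuous g}) ->
  (\int[mu]_(s in `[a, b]) (g s)%:E = (G b - G a)%:E)%E.
Proof.
move=> a0; rewrite le_eqVlt => /predU1P[<- _ _|ab dG cg].
  by rewrite set_itv1 integral_set1 subrr.
have cG (s : R) : 0 < s -> {for s, continuous G}.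
  move=> /dG[dGs _]; apply/differentiable_continuous.
  by apply/derivable1_diffP.
rewrite (@continuous_FTC2 _ g G)//.
- apply: continuous_in_subspaceT => s; rewrite inE/= in_itv/= => /andP[sa _].
  by apply: cg; exact: lt_le_trans sa.
- split.
  + move=> s; rewrite in_itv/= => /andP[sa _].
    by have [] := dG s (lt_trans a0 sa).
  + by apply: cvg_at_right_filter; exact: cG.
  + by apply: cvg_at_left_filter; apply: cG; exact: lt_trans ab.
- move=> s; rewrite in_itv/= => /andP[sa _]; rewrite derive1E.
  by have [] := dG s (lt_trans a0 sa).
Qed.

Lemma continuous_powR_pos (a s : R) : 0 < s -> {for s, continuous (@powR R ^~ a)}.
Proof.
move=> s0; have [d _] := is_derive1_powR a s0.
by apply/differentiable_continuous; apply/derivable1_diffP.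
Qed.

(** The exponent may be negative, so the antiderivative is used on
    [b/(n+1), b] and n tends to infinity. *)
Lemma integral_powR_le (be b : R) : 0 < be -> 0 < b ->
  (\int[mu]_(s in `]0%R, b]) (s `^ (be - 1))%:E <= (b `^ be / be)%:E)%E.
Proof.
move=> be0 b0; pose F n : set R := `[b / n.+1%:R, b]%classic.
have F0 (n : nat) : 0 < b / n.+1%:R :> R by rewrite divr_gt0.
have -> : `]0%R, b]%classic = \bigcup_n F n.
  apply/seteqP; split => s /=.
    rewrite in_itv/= => /andP[s0 sb]; exists (Num.truncn (b / s)) => //=.
    rewrite /F/= in_itv/= sb andbT ler_pdivrMr// mulrC -ler_pdivrMr//.
    by rewrite ltW// truncnS_gt.
  move=> [n _]; rewrite /F/= !in_itv/= => /andP[sn ->].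
  by rewrite (lt_le_trans (F0 n) sn).
have mp : measurable_fun [set: R] (fun s : R => (s `^ (be - 1))%:E).
  by apply/measurable_EFinP; exact: measurable_powR.
have cv : (\int[mu]_(x in F n) (x `^ (be - 1))%:E)%E @[n --> \oo] -->
    (\int[mu]_(x in \bigcup_n F n) (x `^ (be - 1))%:E)%E.
  apply: ge0_nondecreasing_set_cvg_integral.
  - move=> n m nm; rewrite subsetEset => s; rewrite /F/= !in_itv/= => /andP[sn ->].
    rewrite andbT (le_trans _ sn)// ler_pM2l// lef_pV2 ?posrE// ler_nat ltnS//.
  - by move=> n; exact: measurable_itv.
  - by move=> n; exact: measurable_funTS.
  - by move=> n s _; rewrite lee_fin powR_ge0.
rewrite -(cvg_lim _ cv)//; apply: lime_le; first by apply/cvg_ex; eexists; exact: cv.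
near=> n.
have dG (s : R) : 0 < s -> is_derive s 1 (fun s => be^-1 * s `^ be) (s `^ (be - 1)).
  move=> s0; have D := is_derive1_powR be s0.
  have -> : s `^ (be - 1) = be^-1 *: (be * s `^ (be - 1)).
    by rewrite /GRing.scale/= mulrA mulVf ?mul1r// gt_eqF.
  exact: is_deriveZ.
rewrite (FTC2_pos _ _ dG)//.
- by rewrite lee_fin mulrC gerBl// mulr_ge0 ?invr_ge0 ?ltW// powR_gt0.
- by rewrite ler_pdivrMr// ler_pMr// ler1n.
- by move=> s s0; exact: continuous_powR_pos.
Unshelve. all: by end_near. Qed.

Lemma integrable_powR (be b : R) : 0 < be -> 0 < b ->
  mu.-integrable `]0%R, b] (EFin \o (fun s => s `^ (be - 1))).
Proof.
move=> be0 b0; apply/integrableP; split.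
  by apply: measurable_funTS; apply/measurable_EFinP; exact: measurable_powR.
apply: (@le_lt_trans _ _ (\int[mu]_(s in `]0%R, b]) (s `^ (be - 1))%:E)%E).
  rewrite le_eqVlt; apply/orP; left; apply/eqP; apply: eq_integral => s _.
  by rewrite /= ger0_norm// powR_ge0.
by apply: le_lt_trans (integral_powR_le be0 b0) _; rewrite ltry.
Qed.

Lemma integrable_powRZ (k be b : R) : 0 < be -> 0 < b ->
  mu.-integrable `]0%R, b] (EFin \o (fun s => k * s `^ (be - 1))).
Proof.
move=> be0 b0.
have ip : mu.-integrable `]0%R, b] (fun s : R => k%:E * (s `^ (be - 1))%:E)%E.
  by apply: integrableZl => //; exact: integrable_powR.
by apply: eq_integrable ip => // s _.
Qed.

End real_integrals.

Section segment.
Variable R : realType.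
Notation mu := (@lebesgue_measure R).
Notation normc := (@Normc.normc R).
Implicit Types (x y s : R).

Lemma segment_path0 (x y s : R) : segment_path 0 (x +i* y) s = (s * x) +i* (s * y).
Proof. by rewrite /segment_path add0r subr0; simpc. Qed.

Definition ray_fun (f : R[i] -> R[i]) x y s := f ((s * x) +i* (s * y)).

Lemma pcont_ray (f : R[i] -> R[i]) x y s : ccont f ((s * x) +i* (s * y)) ->
  pcont (fun s => f ((s * x) +i* (s * y))) s.
Proof.
apply: (@pcont_comp _ f (fun s => (s * x) +i* (s * y)) (`|x| + `|y|)) => t.
by rewrite (le_trans (normc_le_ReIm _))//= -!mulrBl !normrM; lra.
Qed.

Lemma is_derive_eps (u : R -> R) s (l : R) :
  (forall e : R, 0 < e -> exists2 d, 0 < d & forall h, `|h| < d ->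
     `|u (s + h) - u s - l * h| <= e * `|h|) -> is_derive s 1 u l.
Proof.
move=> H.
have C : h^-1 *: (u (h *: 1 + s) - u s) @[h --> 0^'] --> l.
  apply/cvgrPdist_le => e /H[d d0 {}H]; exists d => //= h; rewrite /ball_/= sub0r normrN.
  move=> hd h0; rewrite /GRing.scale/= mulr1 (addrC h).
  have -> : l - h^-1 * (u (s + h) - u s) = - h^-1 * (u (s + h) - u s - l * h).
    by field.
  rewrite normrM normrN normfV mulrC ler_pdivrMr ?normr_gt0//.
  exact: H.
apply: DeriveDef; first by apply/cvg_ex; exists l.
exact: cvg_lim C.
Qed.

Lemma ReB (z w : R[i]) : complex.Re (z - w) = complex.Re z - complex.Re w.
Proof. by case: z w => [? ?] [? ?]. Qed.

Lemma ImB (z w : R[i]) : complex.Im (z - w) = complex.Im z - complex.Im w.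
Proof. by case: z w => [? ?] [? ?]. Qed.

(** The chain rule along s -> sz. *)
Lemma is_derive_ray (F : R[i] -> R[i]) (l : R[i]) x y s :
  cderiv F ((s * x) +i* (s * y)) l ->
  is_derive s 1 (fun s => complex.Re (F ((s * x) +i* (s * y)))) (complex.Re (l * (x +i* y))) /\
  is_derive s 1 (fun s => complex.Im (F ((s * x) +i* (s * y)))) (complex.Im (l * (x +i* y))).
Proof.
move=> Fl; set z := x +i* y; have := normc_ge0 z => z0.
have n0 : 0 < normc z + 1 by lra.
have H (e : R) : 0 < e -> exists2 d, 0 < d & forall h, `|h| < d ->
    normc (F (((s + h) * x) +i* ((s + h) * y)) - F ((s * x) +i* (s * y)) - h%:C * (l * z))
      <= e * `|h|.
  move=> e0; have e1 : 0 < e / (normc z + 1) by rewrite divr_gt0.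
  have [d d0 {}Fl] := Fl _ e1; exists (d / (normc z + 1)); first by rewrite divr_gt0.
  move=> h; rewrite ltr_pdivlMr// => hd.
  have nh : normc (h%:C * z) <= `|h| * (normc z + 1).
    by rewrite Normc.normcM normc_real ler_wpM2l//; lra.
  have := Fl _ (le_lt_trans nh hd).
  have -> : (s * x) +i* (s * y) + h%:C * z = ((s + h) * x) +i* ((s + h) * y).
    by rewrite /z; simpc; rewrite -!mulrDl.
  rewrite (_ : l * (h%:C * z) = h%:C * (l * z)); last by ring.
  move=> /le_trans; apply; rewrite (le_trans (ler_wpM2l (ltW e1) nh))//.
  by rewrite mulrCA divfK ?gt_eqF// mulrC.
split; apply: is_derive_eps => e /H[d d0 {}H]; exists d => // h /H; apply: le_trans.
  rewrite (_ : _ - _ - _ = complex.Re (F (((s + h) * x) +i* ((s + h) * y)) -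
    F ((s * x) +i* (s * y)) - h%:C * (l * z))); first exact: normr_Re_le.
  by rewrite !ReB; congr (_ - _); case: (l * z) => a b /=; ring.
rewrite (_ : _ - _ - _ = complex.Im (F (((s + h) * x) +i* ((s + h) * y)) -
    F ((s * x) +i* (s * y)) - h%:C * (l * z))); first exact: normr_Im_le.
by rewrite !ImB; congr (_ - _); case: (l * z) => a b /=; ring.
Qed.

Variable f : R[i] -> R[i].
Hypothesis df : differentiable_uhp f.
Variables (K be : R).
Hypothesis K0 : 0 <= K.
Hypothesis be0 : 0 < be.
Hypothesis growth : forall x y, 0 < y -> normc (f (x +i* y)) <= K * y `^ (be - 1).

Local Notation ray := (ray_fun f).

Lemma pcont_ray_uhp x y s : 0 < y -> 0 < s -> pcont (ray x y) s.
Proof.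
move=> y0 s0; apply: (@pcont_ray f x y).
by apply: (ccont_differentiable_uhp df); rewrite mulr_gt0.
Qed.

Lemma ray_bound x y s : 0 < y -> 0 < s ->
  normc (ray x y s) <= K * y `^ (be - 1) * s `^ (be - 1).
Proof.
move=> y0 s0; rewrite (le_trans (growth _ (mulr_gt0 s0 y0)))//.
by rewrite -mulrA powRM ?(ltW s0) ?(ltW y0)// (mulrC (s `^ _)).
Qed.

Lemma integrable_ray (g : R -> R) x y (b : R) : 0 < y -> 0 < b ->
  (forall s : R, 0 < s -> {for s, continuous g}) ->
  (forall s, `|g s| <= normc (ray x y s)) ->
  mu.-integrable `]0%R, b] (EFin \o g).
Proof.
move=> y0 b0 cg gb; set k := K * y `^ (be - 1).
have k0 : 0 <= k by rewrite mulr_ge0// powR_ge0.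
have ip : mu.-integrable `]0%R, b] (EFin \o (fun s => k * s `^ (be - 1))).
  exact: integrable_powRZ.
apply: le_integrable ip => //.
  have mg : measurable_fun (`]0%R, +oo[%classic : set R) g.
    apply: open_continuous_measurable_fun; first exact: interval_open.
    by move=> s; rewrite inE/= in_itv/= andbT => /cg.
  apply/measurable_EFinP; apply: measurable_funS mg => // s /=.
  by rewrite !in_itv/= andbT => /andP[].
move=> s /=; rewrite in_itv/= => /andP[s0 _]; rewrite lee_fin (le_trans (gb s))//.
rewrite ger0_norm; first exact: ray_bound.
by rewrite mulr_ge0// powR_ge0.
Qed.

Definition ray_integral x y (b : R) : R[i] :=
  Rintegral mu `]0%R, b] (fun s => complex.Re (ray x y s)) +i*
  Rintegral mu `]0%R, b] (fun s => complex.Im (ray x y s)).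

Lemma integrable_ray_Re x y (b : R) : 0 < y -> 0 < b ->
  mu.-integrable `]0%R, b] (EFin \o (fun s => complex.Re (ray x y s))).
Proof.
move=> y0 b0; apply: (@integrable_ray _ x y) => // s; last exact: normr_Re_le.
by move=> s0; exact: (pcont_ray_uhp x y0 s0).1.
Qed.

Lemma integrable_ray_Im x y (b : R) : 0 < y -> 0 < b ->
  mu.-integrable `]0%R, b] (EFin \o (fun s => complex.Im (ray x y s))).
Proof.
move=> y0 b0; apply: (@integrable_ray _ x y) => // s; last exact: normr_Im_le.
by move=> s0; exact: (pcont_ray_uhp x y0 s0).2.
Qed.

Lemma ray_integral_bound x y (b : R) : 0 < y -> 0 < b ->
  normc (ray_integral x y b) <= 2 * (K * y `^ (be - 1)) * (b `^ be / be).
Proof.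
move=> y0 b0; set k := K * y `^ (be - 1).
have k0 : 0 <= k by rewrite mulr_ge0// powR_ge0.
have B (g : R -> R) : mu.-integrable `]0%R, b] (EFin \o g) ->
    (forall s, `|g s| <= normc (ray x y s)) ->
    `|Rintegral mu `]0%R, b] g| <= k * (b `^ be / be).
  move=> ig gb; rewrite (le_trans (le_normr_Rintegral _ ig))//.
  have ip := integrable_powR be0 b0.
  have h1 : Rintegral mu `]0%R, b] (fun s => `|g s|) <=
     Rintegral mu `]0%R, b] (fun s => k * s `^ (be - 1)).
    apply: le_Rintegral => //.
    - by move/integrable_abse: ig.
    - exact: integrable_powRZ.
    - move=> s /=; rewrite in_itv/= => /andP[s0 _]; rewrite (le_trans (gb s))//.
      exact: ray_bound.
  rewrite (le_trans h1)// RintegralZl// ler_wpM2l// -lee_fin /Rintegral fineK.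
    exact: integral_powR_le.
  exact: integrable_fin_num.
rewrite (le_trans (normc_le_ReIm _))//=.
have h1 := B _ (integrable_ray_Re x y0 b0) (fun s => normr_Re_le _).
have h2 := B _ (integrable_ray_Im x y0 b0) (fun s => normr_Im_le _).
by rewrite (le_trans (lerD h1 h2))// -mulrA mulr_natl mulr2n.
Qed.

(** The fundamental theorem of calculus on [e, 1], away from the vertex. *)
Lemma ray_integral_split x y (e : R) : 0 < y -> 0 < e -> e <= 1 ->
  (x +i* y) * ray_integral x y 1 = (x +i* y) * ray_integral x y e +
    (primitive f (x +i* y) - primitive f ((e * x) +i* (e * y))).
Proof.
move=> y0 e0 e1; set z := x +i* y.
have split (g : R -> R) : mu.-integrable `]0%R, 1%R] (EFin \o g) ->
   Rintegral mu `]0%R, 1%R] g = Rintegral mu `]0%R, e] g + ointr e 1 g.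
  move=> ig; have := Rintegral_itvB (x := e) ig; rewrite !bnd_simp => /(_ (ltW e0) e1) H.
  rewrite ointr_le// -(@Rintegral_itv_obnd_cbnd _ e); first by rewrite -H addrC subrK.
  by apply: integrableS ig => //; apply: subset_itvr; rewrite bnd_simp ltW.
have E : ray_integral x y 1 = ray_integral x y e + oint e 1 (ray x y).
  rewrite /ray_integral (split _ (integrable_ray_Re x y0 ltr01)).
  by rewrite (split _ (integrable_ray_Im x y0 ltr01)).
have cr s : between e 1 s -> pcont (ray x y) s.
  by move=> /(between_gt0 e0 ltr01); exact: pcont_ray_uhp.
rewrite E mulrDr -ointZ//; congr (_ + _).
have D s : 0 < s -> cderiv (primitive f) ((s * x) +i* (s * y)) (ray x y s).
  by move=> s0; apply: (cderiv_primitive df); rewrite mulr_gt0.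
have cz s : 0 < s -> pcont (fun s => z * ray x y s) s.
  by move=> s0; apply: pcontM; [exact: pcont_cst|exact: pcont_ray_uhp].
apply/eqP; rewrite eq_complex; apply/andP; split; apply/eqP; rewrite [LHS]/=.
- apply: EFin_inj; rewrite EFin_ointr//; last first.
    by move=> s /(between_gt0 e0 ltr01) s0; exact: (cz s s0).1.
  have dRe (s : R) : 0 < s -> is_derive s 1
      (fun s => complex.Re (primitive f ((s * x) +i* (s * y))))
      (complex.Re (z * ray x y s)).
    by move=> s0; rewrite mulrC; exact: (is_derive_ray (D s s0)).1.
  rewrite (FTC2_pos e0 e1 dRe); first by rewrite !mul1r ReB.
  by move=> s s0; exact: (cz s s0).1.
- apply: EFin_inj; rewrite EFin_ointr//; last first.
    by move=> s /(between_gt0 e0 ltr01) s0; exact: (cz s s0).2.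
  have dIm (s : R) : 0 < s -> is_derive s 1
      (fun s => complex.Im (primitive f ((s * x) +i* (s * y))))
      (complex.Im (z * ray x y s)).
    by move=> s0; rewrite mulrC; exact: (is_derive_ray (D s s0)).2.
  rewrite (FTC2_pos e0 e1 dIm); first by rewrite !mul1r ImB.
  by move=> s s0; exact: (cz s s0).2.
Qed.

End segment.

(** * The Cesaro transform is holomorphic *)

Section cesaro_holomorphic.
Variable R : realType.
Notation mu := (@lebesgue_measure R).
Notation normc := (@Normc.normc R).
Implicit Types (x y s : R).
Variable f : R[i] -> R[i].
Hypothesis df : differentiable_uhp f.
Variables (K be : R).
Hypothesis K0 : 0 <= K.
Hypothesis be0 : 0 < be.
Hypothesis be1 : be <= 1.
Hypothesis growth : forall x y, 0 < y -> normc (f (x +i* y)) <= K * y `^ (be - 1).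

Lemma segment_integrable_uhp x y : 0 < y -> segment_integrable f 0 (x +i* y).
Proof.
move=> y0; have sub : `]0%R, 1%R[ `<=` (`]0%R, 1%R]%classic : set R).
  by apply: subset_itvl; rewrite bnd_simp.
have E : (fun s => f (segment_path 0 (x +i* y) s)) = ray_fun f x y.
  by apply/funext => s; rewrite segment_path0.
rewrite /segment_integrable; split.
  rewrite (_ : (fun s : R => _) = fun s => complex.Re (ray_fun f x y s)); last first.
    by rewrite -E.
  by apply: integrableS (integrable_ray_Re df K0 be0 growth x y0 ltr01) => //.
rewrite (_ : (fun s : R => _) = fun s => complex.Im (ray_fun f x y s)); last first.
  by rewrite -E.
by apply: integrableS (integrable_ray_Im df K0 be0 growth x y0 ltr01) => //.
Qed.

Lemma cesaro_ray x y : 0 < y ->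
  cesaro_operator f (x +i* y) = ray_integral f x y 1.
Proof.
move=> y0; have z0 : x +i* y != 0.
  by rewrite eq_complex/= negb_and (gt_eqF y0) orbT.
rewrite /cesaro_operator /segment_integral subr0 mulrA mulVf// mul1r.
have [iRe iIm] := segment_integrable_uhp x y0.
rewrite (Rintegral_itv_bndo_bndc iRe) (Rintegral_itv_bndo_bndc iIm).
by rewrite /ray_integral; congr (_ +i* _); apply: eq_Rintegral => s _ /=;
  rewrite segment_path0.
Qed.

(** Splitting at e, the difference of the two sides consists of the integrals
    over ]0, e] and of F(ez') - F(ez).  The latter is an integral over a path of
    length O(e) on which |f| = O(e^(be - 1)); all terms are O(e^be). *)
Lemma ray_integral_primitive x y x' y' : 0 < y -> 0 < y' ->
  (x +i* y) * ray_integral f x y 1 - primitive f (x +i* y) =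
  (x' +i* y') * ray_integral f x' y' 1 - primitive f (x' +i* y').
Proof.
move=> y0 y'0.
set L := LHS; set L' := RHS.
pose m := Num.min y y'; have m0 : 0 < m by rewrite lt_min y0.
pose C1 x y := normc (x +i* y) * (2 * (K * y `^ (be - 1)) * be^-1).
have C10 u v : 0 <= C1 u v.
  by rewrite /C1 !mulr_ge0 ?normc_ge0 ?powR_ge0// ?invr_ge0 ltW.
pose k := K * m `^ (be - 1).
have k0 : 0 <= k by rewrite mulr_ge0// powR_ge0.
pose C2 := 2 * k * (`|x' - x| + `|y' - y|).
have C20 : 0 <= C2 by rewrite /C2; apply: mulr_ge0; [exact: mulr_ge0|exact: addr_ge0].
pose C := C1 x y + C1 x' y' + C2 + 1.
have C0 : 0 < C by rewrite /C; have := C10 x y; have := C10 x' y'; lra.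
have main (e : R) : 0 < e -> e <= 1 -> normc (L - L') <= C * e `^ be.
  move=> e0 e1.
  have tail u v : 0 < v -> normc ((u +i* v) * ray_integral f u v e) <= C1 u v * e `^ be.
    move=> v0; rewrite Normc.normcM /C1 -mulrA ler_wpM2l ?normc_ge0//.
    rewrite (le_trans (ray_integral_bound df K0 be0 growth u v0 e0))//.
    by rewrite -!mulrA (mulrC (e `^ be)).
  have incr : normc (primitive f ((e * x') +i* (e * y')) -
      primitive f ((e * x) +i* (e * y))) <= C2 * e `^ be.
    have [ey ey'] : 0 < e * y /\ 0 < e * y' by rewrite !mulr_gt0.
    have em : 0 < e * m by rewrite mulr_gt0.
    rewrite (primitive_increment df _ _ ey ey').
    have bd u v : e * m <= v -> normc (f (u +i* v)) <= k * e `^ (be - 1).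
      move=> mv; have v0 : 0 < v by exact: lt_le_trans mv.
      apply: (le_trans (growth _ v0)).
      have -> : k * e `^ (be - 1) = K * (e * m) `^ (be - 1).
        by rewrite powRM ?(ltW e0) ?(ltW m0)// /k; ring.
      apply: ler_wpM2l => //.
      have [|] := ltP be 1 => [b1|b1]; last first.
        have -> : be = 1 by apply/eqP; rewrite eq_le be1.
        by rewrite subrr !powRr0.
      rewrite -opprB !powRN lef_pV2 ?posrE ?powR_gt0//.
      by apply: ge0_ler_powR; rewrite ?nnegrE ?subr_ge0 ?(ltW em) ?(ltW v0).
    have me : e * m <= e * y by rewrite ler_pM2l// ge_min lexx.
    have me' : e * m <= e * y' by rewrite ler_pM2l// ge_min lexx orbT.
    have b1 : normc (oint (e * x) (e * x') (fun s => f (s +i* (e * y)))) <=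
        2 * (k * e `^ (be - 1)) * `|e * x' - e * x|.
      apply: oint_bound => s _; last exact: bd.
      by apply: pcont_hor; exact: (ccont_differentiable_uhp df).
    have b2 : normc (oint (e * y) (e * y') (fun t => f ((e * x') +i* t))) <=
        2 * (k * e `^ (be - 1)) * `|e * y' - e * y|.
      apply: oint_bound => t ht.
        by apply: pcont_ver; apply: (ccont_differentiable_uhp df); exact: between_gt0 ht.
      by apply: bd; case/orP: ht => /andP[h1 h2];
        [exact: le_trans h1|exact: le_trans h1].
    rewrite (le_trans (normc_triangle _ _))// Normc.normcM normc_i mul1r.
    rewrite (le_trans (lerD b1 b2))// -!mulrBr !normrM (gtr0_norm e0).
    have <- : e * e `^ (be - 1) = e `^ be by rewrite mulr_powRB1// ltW.
    by rewrite /C2 le_eqVlt; apply/orP; left; apply/eqP; ring.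
  have E : L - L' = (x +i* y) * ray_integral f x y e -
     (x' +i* y') * ray_integral f x' y' e +
     (primitive f ((e * x') +i* (e * y')) - primitive f ((e * x) +i* (e * y))).
    rewrite /L /L' (ray_integral_split df K0 be0 growth x y0 e0 e1).
    rewrite (ray_integral_split df K0 be0 growth x' y'0 e0 e1); ring.
  rewrite E.
  have t1 := normc_triangle ((x +i* y) * ray_integral f x y e -
     (x' +i* y') * ray_integral f x' y' e)
     (primitive f ((e * x') +i* (e * y')) - primitive f ((e * x) +i* (e * y))).
  have t2 := normc_triangle ((x +i* y) * ray_integral f x y e)
     (- ((x' +i* y') * ray_integral f x' y' e)).
  rewrite normc_opp in t2.
  have := tail x y y0; have := tail x' y' y'0.
  have := powR_ge0 e be.
  rewrite /C !mulrDl mul1r; move: t1 t2 incr; lra.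
apply/eqP; rewrite -subr_eq0 -normc_eq0 eq_le normc_ge0 andbT leNgt; apply/negP => n0.
set n := normc (L - L') in n0 main.
pose v := Num.min 1 (n / (2 * C)).
have v0 : 0 < v by rewrite lt_min ltr01 divr_gt0// mulr_gt0.
have v1 : v <= 1 by rewrite ge_min lexx.
have vn : v <= n / (2 * C) by rewrite ge_min lexx orbT.
have e0 : 0 < v `^ be^-1 by rewrite powR_gt0.
have e1 : v `^ be^-1 <= 1.
  rewrite [leRHS](_ : 1 = 1 `^ be^-1); last by rewrite powR1.
  by rewrite ge0_ler_powR// ?nnegrE ?invr_ge0 ?(ltW v0) ?(ltW be0).
have := main _ e0 e1; rewrite -powRrM mulVf ?gt_eqF// powRr1 ?(ltW v0)//.
move: vn; rewrite ler_pdivlMr ?mulr_gt0//; lra.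
Qed.

(** Near z, the Cesaro transform is (F + k) / z with F a primitive of f. *)
Lemma holomorphic_cesaro : holomorphic_on (@upper_half_plane R) (cesaro_operator f).
Proof.
case=> x y; rewrite /upper_half_plane/= => y0; apply/derivable_cderiv.
pose k := (0 +i* 1) * ray_integral f 0 1 1 - primitive f (0 +i* 1).
have z0 : x +i* y != 0.
  by rewrite eq_complex/= negb_and (gt_eqF y0) orbT.
have [l cF] : exists l, cderiv (fun w : R[i] => (primitive f w - (- k)) * (w - 0)^-1) (x +i* y) l.
  apply: ex_cderivM; last exact: ex_cderiv_inv.
  by apply: ex_cderiv_subC; exists (f (x +i* y)); exact: cderiv_primitive.
exists l; apply: cderiv_ext y0 _ cF => -[u v] uv.
have v0 : 0 < v.
  have : `|v - y| <= normc ((u +i* v) - (x +i* y)).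
    exact: (normr_Im_le ((u +i* v) - (x +i* y))).
  by move=> /le_lt_trans => /(_ _ uv); rewrite ltr_norml; lra.
have w0 : u +i* v != 0.
  by rewrite eq_complex/= negb_and (gt_eqF v0) orbT.
rewrite (cesaro_ray u v0) subr0 opprK.
rewrite /k -(ray_integral_primitive u 0 v0 ltr01) addrC subrK.
by rewrite mulrAC divff// mul1r.
Qed.

End cesaro_holomorphic.

(** * The bound on horizontal means *)

Section cesaro_bound.
Variable R : realType.
Notation mu := (@lebesgue_measure R).
Notation normc := (@Normc.normc R).

(** For w > 0 the choice a = w^(1/r) makes both terms multiples of a; for
    w = 0, a tends to 0. *)
Lemma powR_le_of_split (c w r : R) : 1 < r -> 0 <= c -> 0 <= w ->
  (forall a, 0 < a -> c <= 4 * a + 2 * (a / a `^ r * w)) ->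
  c `^ r <= 6 `^ r * w.
Proof.
move=> r1 c0 w0 H; have r0 : 0 < r by lra.
have [w_0|w_n0] := eqVneq w 0.
  have -> : c = 0.
    apply/eqP; rewrite eq_le c0 andbT leNgt; apply/negP => cp.
    have c8 : 0 < c / 8 by rewrite divr_gt0.
    by have := H _ c8; rewrite w_0; lra.
  by rewrite powR0 ?gt_eqF// mulr_ge0 ?powR_ge0.
have wp : 0 < w by rewrite lt_def w_n0.
have ap : 0 < w `^ r^-1 by rewrite powR_gt0.
have := H _ ap; rewrite -[in X in _ / X]powRrM mulVf ?gt_eqF// powRr1//.
rewrite divfK// => h.
have {}h : c <= 6 * w `^ r^-1 by lra.
have h6 : 0 <= 6 * w `^ r^-1 by rewrite mulr_ge0 ?powR_ge0.
rewrite (le_trans (ge0_ler_powR (ltW r0) _ _ h)) ?nnegrE//.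
by rewrite powRM ?powR_ge0// -powRrM mulVf ?gt_eqF// powRr1.
Qed.

Variable f : R[i] -> R[i].
Hypothesis df : differentiable_uhp f.
Variables (K be r S : R).
Hypothesis K0 : 0 <= K.
Hypothesis be0 : 0 < be.
Hypothesis be1 : be <= 1.
Hypothesis growth : forall x y, 0 < y -> normc (f (x +i* y)) <= K * y `^ (be - 1).
Hypothesis r1 : 1 < r.
Hypothesis S0 : 0 <= S.
Notation N := (uhp_norm f).
Hypothesis NS : forall y, 0 < y -> (\int[mu]_x ((N (x, y)) `^ r)%:E <= S%:E)%E.

(** Its integral over s in ]0, 1] is the function W that dominates |Cf|^r; the
    weight s^((r-1)/2) is the one produced by powR_split with A = a / sqrt s.
    The added zeros put the arguments in the form of affine maps. *)
Definition dilated_energy (y : R) (u : R * R) : \bar R :=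
  (u.2 `^ ((r - 1) / 2) * N (u.2 * u.1 + 0, u.2 * y + 0) `^ r)%:E.

Lemma dilated_energy_ge0 y u : (0 <= dilated_energy y u)%E.
Proof. by rewrite lee_fin mulr_ge0 ?powR_ge0. Qed.

Lemma measurable_dilated_energy y : measurable_fun [set: R * R] (dilated_energy y).
Proof.
apply/measurable_EFinP; apply: measurable_funM.
  exact: (measurableT_comp (measurable_powR _) measurable_snd).
apply: (measurableT_comp (measurable_powR _)).
apply: measurable_uhp_norm_comp => //.
  apply: measurable_funD => //; apply: measurable_funM.
    exact: measurable_snd.
  exact: measurable_fst.
by apply: measurable_funD => //; apply: measurable_funM.
Qed.

Lemma measurable_ray_norm x y : measurable_fun (`]0%R, 1%R]%classic : set R)
  (fun s : R => (N ((s * x + 0)%R, (s * y + 0)%R))%:E).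
Proof.
apply: measurable_funTS; apply/measurable_EFinP; apply: measurable_uhp_norm_comp => //.
  by apply: measurable_funD => //; apply: measurable_funM.
by apply: measurable_funD => //; apply: measurable_funM.
Qed.

Lemma cesaro_le_integral x y : 0 < y ->
  ((normc (cesaro_operator f (x +i* y)))%:E <=
   2%:E * \int[mu]_(s in `]0%R, 1%R]) (N ((s * x + 0)%R, (s * y + 0)%R))%:E)%E.
Proof.
move=> y0; rewrite (cesaro_ray df K0 be0 growth x y0).
have mN := measurable_ray_norm x y.
have B (g : R -> R) : mu.-integrable `]0%R, 1%R] (EFin \o g) ->
    (forall s, `|g s| <= normc (ray_fun f x y s)) ->
    (`|Rintegral mu `]0%R, 1%R] g|%:E <=
     \int[mu]_(s in `]0%R, 1%R]) (N ((s * x + 0)%R, (s * y + 0)%R))%:E)%E.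
  move=> ig gb; have mg : measurable_fun (`]0%R, 1%R]%classic : set R) (EFin \o g).
    exact: measurable_int ig.
  rewrite EFin_normr_Rintegral//.
  apply: (@le_trans _ _ (\int[mu]_(s in `]0%R, 1%R]) `|(g s)%:E|)%E).
    exact: le_abse_integral.
  apply: ge0_le_integral => //.
  - exact: measurableT_comp.
  - move=> s /=; rewrite in_itv/= => /andP[s0 _]; rewrite lee_fin !addr0.
    by rewrite uhp_normE ?mulr_gt0//; exact: gb.
rewrite (le_trans (_ : _ <= (`|complex.Re (ray_integral f x y 1)|%:E +
    `|complex.Im (ray_integral f x y 1)|%:E)%E)%E)//.
  by rewrite -EFinD lee_fin normc_le_ReIm.
rewrite (_ : 2%:E = 1%:E + 1%:E)%E; last by rewrite -EFinD.
rewrite ge0_muleDl ?lee_fin// !mul1e; apply: leeD.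
  apply: B; first exact: (integrable_ray_Re df K0 be0 growth x y0 ltr01).
  by move=> s; exact: normr_Re_le.
apply: B; first exact: (integrable_ray_Im df K0 be0 growth x y0 ltr01).
by move=> s; exact: normr_Im_le.
Qed.

Lemma integral_norm_split x y (a : R) : 0 < y -> 0 < a ->
  (\int[mu]_(s in `]0%R, 1%R]) (N ((s * x + 0)%R, (s * y + 0)%R))%:E <=
   (2 * a)%:E + (a / a `^ r)%:E * \int[mu]_(s in `]0%R, 1%R]) dilated_energy y (x, s))%E.
Proof.
move=> y0 a0; have C0 : 0 <= a / a `^ r by rewrite divr_ge0 ?powR_ge0// ltW.
have mN := measurable_ray_norm x y.
have mp : measurable_fun (`]0%R, 1%R]%classic : set R) (fun s : R => (s `^ (2^-1 - 1))%:E).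
  by apply: measurable_funTS; apply/measurable_EFinP; exact: measurable_powR.
have mE : measurable_fun (`]0%R, 1%R]%classic : set R) (fun s : R => dilated_energy y (x, s)).
  apply: measurable_funTS.
  exact: (measurableT_comp (measurable_dilated_energy y) (pair1_measurable x)).
have mE' : measurable_fun (`]0%R, 1%R]%classic : set R)
    (fun s : R => ((a / a `^ r)%:E * dilated_energy y (x, s))%E).
  exact: emeasurable_funM.
have mp' : measurable_fun (`]0%R, 1%R]%classic : set R)
    (fun s : R => (a%:E * (s `^ (2^-1 - 1))%:E)%E).
  exact: emeasurable_funM.
apply: (@le_trans _ _ (\int[mu]_(s in `]0%R, 1%R])
   (a%:E * (s `^ (2^-1 - 1))%:E + (a / a `^ r)%:E * dilated_energy y (x, s)))%E).
  apply: ge0_le_integral => //.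
  - by move=> s _; rewrite lee_fin uhp_norm_ge0.
  - exact: emeasurable_funD.
  move=> s /=; rewrite in_itv/= => /andP[s0 _].
  rewrite /dilated_energy -!EFinM -EFinD lee_fin.
  have p0 : 0 < s `^ (2^-1 - 1) by rewrite powR_gt0.
  have A0 : 0 < a * s `^ (2^-1 - 1) by rewrite mulr_gt0.
  have := powR_split A0 (uhp_norm_ge0 f (s * x + 0, s * y + 0)) (ltW r1).
  move=> /le_trans; apply; rewrite lerD2l mulrA ler_wpM2r ?powR_ge0//.
  rewrite powRM ?(ltW a0) ?(ltW p0)//.
  (* 2^-1 - 1 is the exponent -1/2, in the form of integral_powR_le. *)
  have -> : s `^ ((r - 1) / 2) = s `^ (2^-1 - 1) / (s `^ (2^-1 - 1)) `^ r.
    rewrite -powRrM -powRB; last by rewrite (gt_eqF s0) implybT.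
    by congr (_ `^ _); field.
  have ar : a `^ r != 0 by rewrite gt_eqF// powR_gt0.
  have sr : (s `^ (2^-1 - 1)) `^ r != 0 by rewrite gt_eqF// powR_gt0.
  by rewrite le_eqVlt; apply/orP; left; apply/eqP; field; rewrite ar sr.
rewrite ge0_integralD//; last 2 first.
- by move=> s _; rewrite -EFinM lee_fin mulr_ge0 ?powR_ge0// ltW.
- by move=> s _; apply: mule_ge0; [rewrite lee_fin|exact: dilated_energy_ge0].
rewrite ge0_integralZl_EFin ?(ltW a0)//; last by move=> s _; rewrite lee_fin powR_ge0.
rewrite ge0_integralZl_EFin//; last by move=> s _; exact: dilated_energy_ge0.
apply: leeD => //.
have h2 : 0 < (2^-1 : R) by rewrite invr_gt0.
have := integral_powR_le h2 (@ltr01 R).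
rewrite powR1 invrK mul1r => h.
rewrite (mulrC 2) EFinM; apply: lee_wpmul2l => //.
by rewrite lee_fin ltW.
Qed.

Lemma cesaro_pointwise x y : 0 < y ->
  ((normc (cesaro_operator f (x +i* y)) `^ r)%:E <=
   (6 `^ r)%:E * \int[mu]_(s in `]0%R, 1%R]) dilated_energy y (x, s))%E.
Proof.
move=> y0; set W := (\int[mu]_(s in _) _)%E.
have W0 : (0 <= W)%E by apply: integral_ge0 => s _; exact: dilated_energy_ge0.
have [Wy|Wfin] := eqVneq W +oo%E.
  by rewrite Wy gt0_muley ?leey// lte_fin powR_gt0.
have {Wfin} : W \is a fin_num by rewrite ge0_fin_numE// lt_neqAle Wfin leey.
move=> /fineK WE; set w := fine W in WE.
have w0 : 0 <= w by rewrite -lee_fin WE.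
rewrite -WE -EFinM lee_fin; apply: powR_le_of_split => //; first exact: normc_ge0.
move=> a a0; rewrite -lee_fin; apply: (le_trans (cesaro_le_integral x y0)).
have := integral_norm_split x y0 a0; rewrite -/W -WE -EFinM -EFinD => h.
have := lee_wpmul2l (_ : 0 <= 2%:E)%E h; rewrite lee_fin => /(_ (ler0n _ _)).
move=> /le_trans; apply; rewrite -EFinM lee_fin; lra.
Qed.

Lemma differentiable_cesaro : differentiable_uhp (cesaro_operator f).
Proof.
move=> x y y0; apply/derivable_cderiv.
exact: (holomorphic_cesaro df K0 be0 be1 growth).
Qed.

(** For fixed s the substitution x -> sx contributes the factor 1/s, and the
    remaining weight s^((r-1)/2 - 1) is integrable at 0 because r > 1. *)
Lemma cesaro_power_integral y : 0 < y ->
  (\int[mu]_x (normc (cesaro_operator f (x +i* y)) `^ r)%:E <=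
   (6 `^ r * (2 / (r - 1)) * S)%:E)%E.
Proof.
move=> y0.
have mE := measurable_dilated_energy y.
have E0 := dilated_energy_ge0 y.
have m1 : measurable_fun [set: R] (fun x : R =>
    (normc (cesaro_operator f (x +i* y)) `^ r)%:E).
  apply/measurable_EFinP; apply: (measurableT_comp (measurable_powR r)).
  have -> : (fun x : R => normc (cesaro_operator f (x +i* y))) =
      (fun x => uhp_norm (cesaro_operator f) (1 * x + 0, y)).
    by apply/funext => x; rewrite uhp_normE// mul1r addr0.
  exact: (measurable_uhp_norm_affine differentiable_cesaro).
have m2 : measurable_fun [set: R] (fun x : R =>
    \int[mu]_(s in `]0%R, 1%R]) dilated_energy y (x, s))%E.
  exact: (@measurable_integral_on _ setT `]0%R, 1%R]%classic measurableT
    (measurable_itv _) _ mE E0).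
apply: (@le_trans _ _ (\int[mu]_x ((6 `^ r)%:E *
    \int[mu]_(s in `]0%R, 1%R]) dilated_energy y (x, s)))%E).
  apply: ge0_le_integral => //.
  - by move=> x _; rewrite lee_fin powR_ge0.
  - exact: emeasurable_funM.
  - by move=> x _; exact: cesaro_pointwise.
rewrite ge0_integralZl_EFin ?powR_ge0//; last first.
  by move=> x _; exact: integral_ge0.
rewrite -mulrA EFinM; apply: lee_wpmul2l; first by rewrite lee_fin powR_ge0.
rewrite (@tonelli_on _ setT `]0%R, 1%R]%classic measurableT (measurable_itv _) _ mE E0).
have r12 : 0 < (r - 1) / 2 by rewrite divr_gt0// subr_gt0.
apply: (@le_trans _ _ (\int[mu]_(s in `]0%R, 1%R]) (S%:E * (s `^ ((r - 1) / 2 - 1))%:E))%E).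
  apply: ge0_le_integral; first exact: measurable_itv.
  - by move=> s _; exact: integral_ge0.
  - have mE' : measurable_fun [set: R * R] (fun u : R * R => dilated_energy y (u.2, u.1)).
      exact: (measurableT_comp mE (measurable_fun_pair measurable_snd measurable_fst)).
    exact: (@measurable_integral_on _ `]0%R, 1%R]%classic setT (measurable_itv _)
      measurableT (fun u => dilated_energy y (u.2, u.1)) mE' (fun u => E0 _)).
  - apply: measurable_funTS; apply: emeasurable_funM => //.
    by apply/measurable_EFinP; exact: measurable_powR.
  move=> s /=; rewrite in_itv/= => /andP[s0 _].
  have sy0 : 0 < s * y + 0 by rewrite addr0 mulr_gt0.
  have mNr : measurable_fun [set: R] (fun x : R => (N (x, (s * y + 0)%R) `^ r)%:E).
    apply/measurable_EFinP; apply: (measurableT_comp (measurable_powR r)).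
    by apply: measurable_uhp_norm_comp => //; exact: measurable_cst.
  have mNr' : measurable_fun [set: R] (fun x : R => (N ((s * x + 0)%R, (s * y + 0)%R) `^ r)%:E).
    apply/measurable_EFinP; apply: (measurableT_comp (measurable_powR r)).
    exact: measurable_uhp_norm_affine.
  rewrite /dilated_energy/=; under eq_integral do rewrite EFinM.
  rewrite ge0_integralZl_EFin ?powR_ge0//; last by move=> x _; rewrite lee_fin powR_ge0.
  have := NS sy0; rewrite (@ge0_integral_affine _ s 0) ?gt_eqF//; last first.
    by move=> x; rewrite lee_fin powR_ge0.
  rewrite gtr0_norm//; set I := (\int[mu]_x _)%E => h.
  have -> : ((s `^ ((r - 1) / 2))%:E * I =
     (s `^ ((r - 1) / 2 - 1))%:E * (s%:E * I))%E.
    rewrite muleA -EFinM; congr (_%:E * _)%E.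
    by rewrite [RHS]mulrC mulr_powRB1// ltW.
  by rewrite [leRHS]muleC; apply: lee_wpmul2l => //; rewrite lee_fin powR_ge0.
rewrite ge0_integralZl_EFin//; last 2 first.
- by move=> s _; rewrite lee_fin powR_ge0.
- by apply: measurable_funTS; apply/measurable_EFinP; exact: measurable_powR.
rewrite (mulrC (2 / (r - 1))) [leRHS]EFinM; apply: lee_wpmul2l.
  by rewrite lee_fin.
have := integral_powR_le r12 (@ltr01 R).
by rewrite powR1 mul1r invf_div.
Qed.

End cesaro_bound.

(** * Hardy spaces *)

Section hardy_spaces.
Variable R : realType.
Notation mu := (@lebesgue_measure R).
Notation normc := (@Normc.normc R).
Implicit Type f : R[i] -> R[i].

Lemma differentiable_holomorphic f :
  holomorphic_on (@upper_half_plane R) f -> differentiable_uhp f.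
Proof. by move=> hf x y y0; apply/derivable_cderiv; exact: hf. Qed.

Definition cesaro_bounded (p : \bar R) (M : R) := forall f, hardy p f ->
  [/\ forall z : R[i], upper_half_plane z -> segment_integrable f 0 z,
      holomorphic_on (@upper_half_plane R) (cesaro_operator f) &
      (hardy_norm p (cesaro_operator f) <= M%:E * hardy_norm p f)%E].

Lemma cesaro_bounded_infty : cesaro_bounded +oo%E 2.
Proof.
move=> f [/differentiable_holomorphic df fy].
have ub z : upper_half_plane z -> ((normc (f z))%:E <= hardy_norm +oo f)%E.
  by move=> zU; apply: ereal_sup_ubound; exists z.
have iU : upper_half_plane (0 +i* 1 : R[i]) by rewrite /upper_half_plane/=.
have f0 : (0 <= hardy_norm +oo f)%E.
  by apply: le_trans (ub _ iU); rewrite lee_fin normc_ge0.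
have : hardy_norm +oo f \is a fin_num by rewrite ge0_fin_numE.
move=> /fineK; set B := fine _ => BE.
have B0 : 0 <= B by rewrite -lee_fin BE.
have growth (x y : R) : 0 < y -> normc (f (x +i* y)) <= B * y `^ (1 - 1).
  by move=> y0; rewrite subrr powRr0 mulr1 -lee_fin BE; exact: ub.
split.
- by case=> x y /= y0; exact: (segment_integrable_uhp df B0 ltr01 growth).
- exact: (holomorphic_cesaro df B0 ltr01 (lexx _) growth).
- rewrite -BE -EFinM; apply: ge_ereal_sup => _ [[x y] y0 <-].
  rewrite lee_fin (cesaro_ray df B0 ltr01 growth)//.
  apply: (le_trans (ray_integral_bound df B0 ltr01 growth x y0 ltr01)).
  by rewrite subrr !powRr0 powR1 invr1 !mulr1.
Qed.

Lemma cesaro_bounded_finite (r : R) : 1 < r ->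
  cesaro_bounded r%:E ((6 `^ r * (2 / (r - 1))) `^ r^-1).
Proof.
move=> r1 f [/differentiable_holomorphic df fy].
have r0 : 0 < r by lra.
have rV0 : r^-1 != 0 by rewrite invr_eq0 gt_eqF.
pose I g y := (\int[mu]_x (normc (g (x +i* y)) `^ r)%:E)%E.
pose sup_I g := ereal_sup [set I g y | y in [set y : R | (0 < y)%R]].
have normE g : hardy_norm r%:E g = (sup_I g `^ r^-1)%E by [].
rewrite normE in fy; rewrite !normE; set A := sup_I f in fy *.
have ub y : 0 < y -> (I f y <= A)%E.
  by move=> y0; apply: ereal_sup_ubound; exists y.
have A0 : (0 <= A)%E.
  by apply: le_trans (ub _ ltr01); apply: integral_ge0 => x _; rewrite lee_fin powR_ge0.
have : A \is a fin_num.
  rewrite ge0_fin_numE// ltey; apply/eqP => Ay.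
  by move: fy; rewrite Ay poweRyr.
move=> /fineK; set S := fine _ => SE.
have S0 : 0 <= S by rewrite -lee_fin SE.
have NS (y : R) : 0 < y -> (\int[mu]_x ((uhp_norm f (x, y)) `^ r)%:E <= S%:E)%E.
  move=> y0; rewrite SE; apply: le_trans (ub _ y0).
  rewrite le_eqVlt; apply/orP; left; apply/eqP; apply: eq_integral => x _.
  by rewrite uhp_normE.
pose K := (20 + 5 * S) * 4 `^ r^-1; pose be := 1 - r^-1.
have rV1 : r^-1 < 1 by rewrite invf_lt1.
have rVp : 0 < r^-1 by rewrite invr_gt0.
have K0 : 0 <= K by rewrite mulr_ge0 ?powR_ge0//; lra.
have be0 : 0 < be by rewrite /be; lra.
have be1 : be <= 1 by rewrite /be; lra.
have growth (x y : R) : 0 < y -> normc (f (x +i* y)) <= K * y `^ (be - 1).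
  move=> y0; rewrite (le_trans (growth_bound df r1 S0 NS x y0))//.
  have -> : be - 1 = - r^-1 by rewrite /be; ring.
  have E4 : (4^-1 : R) `^ (- r^-1) = 4 `^ r^-1.
    by rewrite -(@powR_inv1 _ 4)// -powRrM mulN1r opprK.
  have -> : (y / 4) `^ (- r^-1) = 4 `^ r^-1 * y `^ (- r^-1).
    by rewrite powRM ?invr_ge0 ?(ltW y0)// E4 mulrC.
  by rewrite mulrA.
split.
- by case=> x y /= y0; exact: (segment_integrable_uhp df K0 be0 growth).
- exact: (holomorphic_cesaro df K0 be0 be1 growth).
- set D := 6 `^ r * (2 / (r - 1)).
  have D0 : 0 <= D by rewrite mulr_ge0 ?powR_ge0// divr_ge0// subr_ge0 ltW.
  rewrite -SE poweR_EFin -EFinM -powRM// -poweR_EFin.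
  have le : (sup_I (cesaro_operator f) <= (D * S)%:E)%E.
    apply: ge_ereal_sup => _ [y y0 <-].
    exact: (cesaro_power_integral df K0 be0 be1 growth r1 S0 NS).
  apply: gt0_ler_poweR => //; first exact: ltW.
    rewrite in_itv/= leey andbT.
    apply: (@le_trans _ _ (I (cesaro_operator f) 1)).
      by apply: integral_ge0 => x _; rewrite lee_fin powR_ge0.
    by apply: ereal_sup_ubound; exists 1 => /=.
  by rewrite in_itv/= leey andbT lee_fin mulr_ge0.
Qed.

Lemma hardy_norm_ge0 (p : \bar R) f : (0 <= hardy_norm p f)%E.
Proof.
case: p => [r||]; rewrite /hardy_norm; [exact: poweR_ge0| |exact: lexx].
apply: (@le_trans _ _ (normc (f (0 +i* 1)))%:E).
  by rewrite lee_fin normc_ge0.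
apply: ereal_sup_ubound; exists (0 +i* 1) => //.
by rewrite /upper_half_plane/=.
Qed.

Lemma cesaro_bounded_gt1 (p : \bar R) : (1 < p)%E -> exists M, cesaro_bounded p M.
Proof.
case: p => [r||//]; last by exists 2; exact: cesaro_bounded_infty.
rewrite lte_fin => r1; exists ((6 `^ r * (2 / (r - 1))) `^ r^-1).
exact: cesaro_bounded_finite.
Qed.

End hardy_spaces.

Theorem theorem1 (R : realType) (p : \bar R) (p_gt1 : (1 < p)%E) :
  (forall f : R[i] -> R[i], hardy p f ->
     (forall z : R[i], upper_half_plane z -> segment_integrable f 0 z) /\
     hardy p (cesaro_operator f)) /\
  (exists M : R, forall f : R[i] -> R[i], hardy p f ->
     (hardy_norm p (cesaro_operator f) <= M%:E * hardy_norm p f)%E).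
Proof.
have [M CM] := cesaro_bounded_gt1 p_gt1.
split; last by exists M => f /CM[].
move=> f hf; have [si hol le] := CM f hf; split => //; split => //.
have [_ fy] := hf; apply: le_lt_trans le _.
have : hardy_norm p f \is a fin_num by rewrite ge0_fin_numE// hardy_norm_ge0.
by move=> /fineK <-; rewrite -EFinM ltry.
Qed.
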